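(* Let $v=(\beta_1,\beta_2,\tau_1,\tau_2)\in(0,1)^4$ with $\tau_1+\tau_2<1$, let $p\in(0,1)$, and let $b_v^p=b^p\circ\pi_v^{-1}$. If $p\log\beta_1+(1-p)\log\beta_2\ge p\log\tau_1+(1-p)\log\tau_2$, then $$\dim b_v^p=-\frac{p\log p+(1-p)\log(1-p)}{\log 2}+\frac{p\log p+(1-p)\log(1-p)}{p\log\tau_1+(1-p)\log\tau_2}+\Bigl(1-\frac{p\log\beta_1+(1-p)\log\beta_2}{p\log\tau_1+(1-p)\log\tau_2}\Bigr)\dim\pi_{\beta_1,\beta_2}(b^p).$$ If $p\log\beta_1+(1-p)\log\beta_2< p\log\tau_1+(1-p)\log\tau_2$, then $$\dim b_v^p=-\frac{p\log p+(1-p)\log(1-p)}{\log 2}+\frac{p\log p+(1-p)\log(1-p)}{p\log\beta_1+(1-p)\log\beta_2}+\Bigl(1-\frac{p\log\tau_1+(1-p)\log\tau_2}{p\log\beta_1+(1-p)\log\beta_2}\Bigr)\dim\pi_{\tau_1,\tau_2}(b^p).$$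
   Context: System. Let $\mathbb{W}=[-1,1]^3$. For $v=(\beta_1,\beta_2,\tau_1,\tau_2)\in(0,1)^4$ with $\tau_1+\tau_2<1$ define $f_v:\mathbb{W}\to\mathbb{W}$ by $$f_v(x,y,z)=\begin{cases}(2x-1,\ \beta_1y+(1-\beta_1),\ \tau_1z+(1-\tau_1)) & \text{if } x\ge 0,\\ (2x+1,\ \beta_2y-(1-\beta_2),\ \tau_2z-(1-\tau_2)) & \text{if } x<0,\end{cases}$$ and $\Lambda_v=\overline{\bigcap_{n=0}^{\infty}f_v^n(\mathbb{W})}$. Coding. Let $\Sigma=\{-1,1\}^{\mathbb{Z}}$. For $\gamma_1,\gamma_2\in(0,1)$ and $s\in\Sigma$ put $$\hat\pi_{\gamma_1,\gamma_2}(s)=\sum_{k=0}^\infty s_k\,\gamma_2^{\sharp(s,k)}\gamma_1^{\bar\sharp(s,k)}\in\Bigl[\tfrac{-\gamma_2}{1-\gamma_2},\tfrac{\gamma_1}{1-\gamma_1}\Bigr],$$ where $\sharp(s,k)$ (resp. $\bar\sharp(s,k)$) is the number of indices $i\in\{0,\dots,k\}$ with $s_i=-1$ (resp. $s_i=1$). Let $L_{\gamma_1,\gamma_2}$ be the increasing affine bijection of this interval onto $[-1,1]$ and $\pi_{\gamma_1,\gamma_2}=L_{\gamma_1,\gamma_2}\circ\hat\pi_{\gamma_1,\gamma_2}$. Let $i(s)=\sum_{k=1}^\infty s_{-k}2^{-k}$. The coding map is $\pi_v:\Sigma\to\Lambda_v$, $\pi_v(s)=(i(s),\pi_{\beta_1,\beta_2}(s),\pi_{\tau_1,\tau_2}(s))$.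 Measures. $b^p$ is the Bernoulli measure on $\Sigma$: the product of the measure on $\{-1,1\}$ giving $1$ probability $p$ and $-1$ probability $1-p$. $\pi_{\gamma_1,\gamma_2}(b^p)=b^p\circ\pi_{\gamma_1,\gamma_2}^{-1}$ is the push-forward on $[-1,1]$. Dimension. A Borel probability measure $\nu$ on $\mathbb{R}^q$ is exact dimensional if there is a constant $c$ with $\lim_{\epsilon\to0}\frac{\log\nu(B_\epsilon(x))}{\log\epsilon}=c$ for $\nu$-almost all $x$; then $\dim\nu:=c$. The measures appearing here are exact dimensional. *)

(* Defs.v *)
From HB Require Import structures.
From mathcomp Require Import all_boot all_order all_algebra.
From mathcomp Require Import all_classical all_reals all_analysis.
From mathcomp Require Import measurable_realfun.

Set Implicit Arguments.
Unset Strict Implicit.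
Unset Printing Implicit Defensive.

Import Order.TTheory GRing.Theory Num.Theory.
Import numFieldNormedType.Exports.

Local Open Scope classical_set_scope.
Local Open Scope ring_scope.

Section limit_of_measurable_functions.
Context d (T : measurableType d) (R : realType).
Variable f : (T -> R)^nat.
Hypothesis mf : forall n, measurable_fun [set: T] (f n).

Lemma cvgn_cauchy_setE : [set x | cvgn (f ^~ x)] =
  \bigcap_k \bigcup_N \bigcap_m
    [set x | `|f N x - f (N + m)%N x| < k.+1%:R^-1].
Proof.
apply/seteqP; split => x /=.
- move=> cfx k _.
  have k0 : (0 : R) < k.+1%:R^-1 by rewrite invr_gt0.
  have /cauchy_cvgP/cauchy_ballP cx := cfx.
  have := cx _ k0; rewrite near_map2 -ball_normE => -[[A B]] /=.
  move=> [[a _ Aa] [b _ Bb] AB]; exists (maxn a b) => // m _ /=.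
  apply: (AB (maxn a b, maxn a b + m)%N); split => /=.
    by apply: Aa; rewrite /= leq_maxl.
  by apply: Bb; rewrite /= (leq_trans (leq_maxr a b)) ?leq_addr.
- move=> H; apply: cauchy_cvg; apply: cauchy_exP => e e0.
  have [k ke] : exists k, k.+1%:R^-1 < e.
    exists (Num.truncn e^-1); rewrite -[ltRHS]invrK ltf_pV2 ?posrE ?invr_gt0//.
    by rewrite truncnS_gt.
  have [N _ HN] := H k I.
  exists (f N x); exists N => // n /= Nn.
  rewrite -ball_normE /=; have := HN (n - N)%N I; rewrite /= subnKC//.
  by move/lt_trans; exact.
Qed.

Lemma measurable_cvgn_set : measurable [set x | cvgn (f ^~ x)].
Proof.
rewrite cvgn_cauchy_setE; apply: bigcapT_measurable => k.
apply: bigcupT_measurable => N; apply: bigcapT_measurable => m.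
have mh : measurable_fun [set: T] (fun x => `|f N x - f (N + m)%N x|).
  by apply: measurableT_comp => //; apply: measurable_funB; exact: mf.
have := measurable_fun_ltr mh (measurable_cst (k.+1%:R^-1 : R)).
by move=> /(_ measurableT [set true] I); rewrite setTI preimage_true.
Qed.

(* No convergence hypothesis: the limit of a divergent sequence is a fixed
   default value, and the set of convergence is measurable. *)
Lemma measurable_fun_limn : measurable_fun [set: T] (fun x => limn (f ^~ x)).
Proof.
have mC := measurable_cvgn_set.
pose C := [set x | cvgn (f ^~ x)].
rewrite -(setvU C); apply/measurable_funU => //; first exact: measurableC.
split.
  apply: (@eq_measurable_fun _ _ _ _ _ (cst point)); last exact: measurable_cst.
  by move=> x; rewrite inE /C /= => /dvgP ->.
apply: (@measurable_fun_cvg _ _ _ _ f) => // n.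
exact: measurable_funTS.
Qed.

End limit_of_measurable_functions.

Section coding_space.

(* A two-sided sequence is a map int -> bool; the symbols 1 and -1 are encoded
   by true and false. *)
Definition symbol_events : set (set (int -> bool)) :=
  [set A | exists k : int, A = [set s : int -> bool | s k]].

Definition Sigma := g_sigma_algebraType symbol_events.

Lemma measurable_symbol (k : int) :
  measurable_fun [set: Sigma] (fun s : Sigma => s k).
Proof.
apply: (measurable_fun_bool true); rewrite setTI.
by apply: sub_sigma_algebra; exists k; apply/seteqP; split.
Qed.

Definition num_minus (s : Sigma) (k : nat) : nat :=
  #|[pred i : 'I_k.+1 | ~~ s (i : nat)%:Z]|.

Definition num_plus (s : Sigma) (k : nat) : nat :=
  #|[pred i : 'I_k.+1 | s (i : nat)%:Z]|.

End coding_space.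

Section coding_map.
Context {R : realType}.
Implicit Types (g : R) (s : Sigma).

Definition letter (b : bool) : R := if b then 1 else -1.

Definition pi_hat (g1 g2 : R) s : R :=
  \big[+%R/0]_(0 <= k <oo)
    (letter (s k%:Z) * g2 ^+ num_minus s k * g1 ^+ num_plus s k).

Definition affine_normalization (g1 g2 t : R) : R :=
  let a := - g2 / (1 - g2) in
  let b := g1 / (1 - g1) in
  2 * (t - a) / (b - a) - 1.

Definition pi1 (g1 g2 : R) s : R := affine_normalization g1 g2 (pi_hat g1 g2 s).

Definition past s : R :=
  \big[+%R/0]_(1 <= k <oo) (letter (s (- k%:Z)) / 2 ^+ k).

Definition pi_line (g1 g2 : R) s : 1.-tuple R := [tuple pi1 g1 g2 s].

Definition pi_cube (b1 b2 t1 t2 : R) s : 3.-tuple R :=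
  [tuple past s; pi1 b1 b2 s; pi1 t1 t2 s].

Lemma measurable_letter (k : int) :
  measurable_fun [set: Sigma] (fun s : Sigma => letter (s k) : R).
Proof. exact: (measurableT_comp (f := letter) _ (measurable_symbol k)). Qed.

Lemma pow_num_minusE g s k :
  g ^+ num_minus s k = \prod_(i < k.+1) (if s (i : nat)%:Z then 1 else g).
Proof.
rewrite /num_minus -prodr_const big_mkcond /=; apply: eq_bigr => i _.
by rewrite inE; case: (s _).
Qed.

Lemma pow_num_plusE g s k :
  g ^+ num_plus s k = \prod_(i < k.+1) (if s (i : nat)%:Z then g else 1).
Proof.
rewrite /num_plus -prodr_const big_mkcond /=; apply: eq_bigr => i _.
by rewrite inE.
Qed.

Lemma measurable_pi_hat g1 g2 : measurable_fun [set: Sigma] (pi_hat g1 g2).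
Proof.
apply: (measurable_fun_limn (f := fun n s => \sum_(0 <= k < n)
  (letter (s k%:Z) * g2 ^+ num_minus s k * g1 ^+ num_plus s k))) => n.
apply: measurable_sum => k; apply: measurable_funM.
  apply: measurable_funM; first exact: measurable_letter.
  apply: (eq_measurable_fun (fun s : Sigma =>
      \prod_(i < k.+1) (if s (i : nat)%:Z then 1 else g2) : R)).
    by move=> s _; rewrite pow_num_minusE.
  apply: measurable_prod => i _.
  exact: (measurableT_comp (f := fun b : bool => if b then 1 else g2) _
    (measurable_symbol i)).
apply: (eq_measurable_fun (fun s : Sigma =>
    \prod_(i < k.+1) (if s (i : nat)%:Z then g1 else 1) : R)).
  by move=> s _; rewrite pow_num_plusE.
apply: measurable_prod => i _.
exact: (measurableT_comp (f := fun b : bool => if b then g1 else 1) _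
  (measurable_symbol i)).
Qed.

Lemma measurable_pi1 g1 g2 : measurable_fun [set: Sigma] (pi1 g1 g2).
Proof.
rewrite /pi1 /affine_normalization; apply: measurable_funB => //.
apply: measurable_funM => //; apply: measurable_funM => //.
by apply: measurable_funB => //; exact: measurable_pi_hat.
Qed.

Lemma measurable_past : measurable_fun [set: Sigma] past.
Proof.
apply: (measurable_fun_limn (f := fun n s => \sum_(1 <= k < n)
  (letter (s (- k%:Z)) / 2 ^+ k))) => n.
by apply: measurable_sum => k; apply: measurable_funM => //;
  exact: measurable_letter.
Qed.

Let measurable_pi_line g1 g2 : measurable_fun [set: Sigma] (pi_line g1 g2).
Proof.
by apply/measurable_fun_tnthP => -[[|//] i] /=; exact: measurable_pi1.
Qed.

HB.instance Definition _ g1 g2 := isMeasurableFun.Build _ _ _ _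
  (pi_line g1 g2) (measurable_pi_line g1 g2).

Let measurable_pi_cube b1 b2 t1 t2 :
  measurable_fun [set: Sigma] (pi_cube b1 b2 t1 t2).
Proof.
apply/measurable_fun_tnthP => -[[|[|[|//]]] i] /=.
- exact: measurable_past.
- exact: measurable_pi1.
- exact: measurable_pi1.
Qed.

HB.instance Definition _ b1 b2 t1 t2 := isMeasurableFun.Build _ _ _ _
  (pi_cube b1 b2 t1 t2) (measurable_pi_cube b1 b2 t1 t2).

End coding_map.

(* The product of the measures bernoulli_prob p on bool, i.e. of the measures
   giving true mass p and false mass 1 - p: the probability measure determined
   by its values on the cylinder sets. *)
Definition is_bernoulli_measure {R : realType} (p : R)
    (P : probability Sigma R) : Prop :=
  forall (J : seq int) (a : int -> bool), uniq J ->
    P [set s : Sigma | forall k, k \in J -> s k = a k] =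
    (\prod_(k <- J) bernoulli_pmf p (a k))%:E.

Section exact_dimension.
Context {R : realType} {q : nat}.
Implicit Types (nu : probability (q.-tuple R) R) (x : q.-tuple R) (e c : R).

Definition euclidean_ball x e : set (q.-tuple R) :=
  [set y | Num.sqrt (\sum_(i < q) (tnth y i - tnth x i) ^+ 2) < e].

(* The value ln 0 = 0 is harmless: almost every x lies in the support of nu,
   so that all the balls around x have positive measure. *)
Definition has_dimension nu c : Prop :=
  {ae nu, forall x,
    (fun e => ln (fine (nu (euclidean_ball x e))) / ln e) @ 0^'+ --> c}.

Definition exact_dimensional nu : Prop := exists c, has_dimension nu c.

Definition dimension nu : R := xget 0 [set c | has_dimension nu c].

Lemma has_dimension_unique nu c c' :
  has_dimension nu c -> has_dimension nu c' -> c = c'.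
Proof.
move=> hc hc'; have : {ae nu, forall x : q.-tuple R, c = c'}.
  by apply: filterS2 hc hc' => x h h'; exact: (cvg_unique _ h h').
have [//|/eqP cc'] := eqVneq c c'.
move=> [A [mA A0]] /(_ _ cc') TA.
have AT : A = setT by apply/seteqP; split.
by move: A0; rewrite AT probability_setT => /eqP; rewrite onee_eq0.
Qed.

Lemma dimensionE nu c : has_dimension nu c -> dimension nu = c.
Proof.
move=> hc; rewrite /dimension; case: xgetP => [d _ hd|/(_ c)//].
exact: (has_dimension_unique hd hc).
Qed.

End exact_dimension.

Definition mean_log {R : realType} (p a b : R) : R :=
  p * ln a + (1 - p) * ln b.

(* Main.v *)
(* Exact dimensionality is assumed, so each dimension only has to be computed
   along one sequence of balls, in probability. Let [chi_t] and [chi_b] be the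
   Lyapunov exponents of (t1, t2) and (b1, b2), and consider a ball of radius
   exp(- n chi_t), up to factors exp(o(n)). Since [t1 + t2 < 1], its third
   coordinate fixes the symbols 0, .., n - 1, and its first coordinate fixes
   about [n chi_t / ln 2] past symbols. On that cylinder the second coordinate
   is an affine copy, of ratio exp(- n chi_b), of the line coordinate of the
   shifted sequence, which is independent of the cylinder. Hence

     mass of the ball  ~  mass of the cylinder * mass of a line ball,

   where the line ball has radius exp(- n (chi_t - chi_b)) and is centred at the
   image of [shift n s]. The law of [shift n s] does not depend on [n], so the
   second factor is governed, in probability, by the dimension of the line
   measure; the weak law of large numbers gives all the other rates. When
   [chi_t < chi_b] the second factor has rate 0, and one concludes with
   [dim (t-line) = entropy / chi_t]. *)

Require Import Defs.
From HB Require Import structures.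
From mathcomp Require Import all_boot all_order all_algebra.
From mathcomp Require Import all_classical all_reals all_analysis.
From mathcomp Require Import measurable_realfun ring lra zify.

Set Implicit Arguments.
Unset Strict Implicit.
Unset Printing Implicit Defensive.

Import Order.TTheory GRing.Theory Num.Theory.
Import numFieldNormedType.Exports.

Local Open Scope classical_set_scope.
Local Open Scope ring_scope.

(** * Convergence in probability as a filter *)

Section with_high_probability.
Context d (T : measurableType d) (R : realType) (P : probability T R).

(* Convergence along this filter on pairs (time, point) is convergence in
   probability. *)
Definition whp : set_system (nat * T) :=
  [set A | forall e : R, 0 < e -> \forall n \near \oo, exists B : set T,
     [/\ measurable B, [set s | ~ A (n, s)] `<=` B & (P B <= e%:E)%E]].

(** Intersections come from the union bound. Properness holds because a set of mass at most 1/2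
    cannot be everything; it lets [rate_le] extract an actual pair from a [near] statement. *)
Global Instance whp_filter : ProperFilter whp.
Proof.
split.
  move=> /(_ 2^-1 (ltac:(by rewrite invr_gt0))) [N _ /(_ N (leqnn N))].
  move=> [B [mB BT PB]]; have BE : B = setT.
    by apply/seteqP; split => // s _; apply: BT => /=; tauto.
  move: PB; rewrite BE probability_setT lee_fin.
  by apply/negP; rewrite -ltNge invf_lt1 ?ltr1n.
split.
- move=> e e0; apply: nearW => n; exists set0; split => //.
    by move=> s /= /(_ I).
  by rewrite measure0 lee_fin ltW.
- move=> A A' hA hA' e e0.
  have e20 : 0 < e / 2 by rewrite divr_gt0.
  apply: filterS2 (hA _ e20) (hA' _ e20) => n [B [mB AB PB]] [B' [mB' AB' PB']].
  exists (B `|` B'); split; first exact: measurableU.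
    by move=> s /= /not_andP[/AB|/AB']; [left|right].
  by rewrite (le_trans (measureU2 _ mB mB'))// (splitr e) EFinD leeD.
- move=> A A' AA' hA e e0; apply: filterS (hA _ e0) => n [B [mB AB PB]].
  exists B; split => // s /= nA; apply: AB => /= /AA'; exact: nA.
Qed.

Lemma whp_time : (fun z : nat * T => z.1) @ whp --> \oo.
Proof.
move=> A [N _ NA] e e0; exists N => // n Nn; exists set0; split => //.
  by move=> s /=; apply; exact: NA.
by rewrite measure0 lee_fin ltW.
Qed.

Lemma cvg_whp (V : topologicalType) (u : nat -> V) (l : V) :
  u @ \oo --> l -> u z.1 @[z --> whp] --> l.
Proof. by move=> ul; apply: (cvg_comp _ _ whp_time ul). Qed.

Lemma near_whp (Q : nat -> Prop) :
  (\forall n \near \oo, Q n) -> \forall z \near whp, Q z.1.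
Proof. exact: whp_time. Qed.

(** Egorov's theorem: almost sure convergence is uniform off a set of small mass, which serves as
    exceptional set at all large times. *)
Lemma ae_cvg_whp (f : (T -> R)^nat) (l : R) :
  (forall n, measurable_fun setT (f n)) ->
  {ae P, forall s, f ^~ s @ \oo --> l} ->
  (fun z => f z.1 z.2) @ whp --> l.
Proof.
move=> mf fl; apply/cvgrPdist_lt => a a0 e e0.
have Poo : (P setT < +oo)%E by rewrite probability_setT ltry.
have fl' : {ae P, forall s, setT s -> f ^~ s @ \oo --> cst l s}.
  by apply: filterS fl => s.
have [B [mB Be ul]] :=
  ae_pointwise_almost_uniform mf (measurable_cst l) measurableT Poo fl' e0.
have : nbhs (cst l : {uniform` setT `\` B -> R})
    [set h | forall s, (setT `\` B) s -> ball (cst l s) a (h s)].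
  apply/uniform_nbhs; exists [set xy | ball xy.1 a xy.2].
  split; last by [].
  exact: (@entourage_ball R R (PosNum a0)).
move=> /ul[N _ HN]; exists N => // n Nn; exists B; split => //; last exact: ltW.
by move=> s /= ns; apply: contrapT => Bs; apply: ns; exact: (HN n Nn s).
Qed.

End with_high_probability.

(** * Cylinders and independence *)

Section cylinders.
Context (R : realType).
Implicit Types (J : seq int) (a : int -> bool) (s : Sigma).

Definition cylinder J a : set Sigma := [set s | forall k, k \in J -> s k = a k].

Lemma measurable_cylinder J a : measurable (cylinder J a).
Proof.
elim: J => [|k J mJ].
  rewrite (_ : cylinder [::] a = setT)//.
  by apply/seteqP; split.
rewrite (_ : cylinder _ _ =
    (fun s : Sigma => s k) @^-1` [set a k] `&` cylinder J a).
  apply: measurableI => //; rewrite -[X in measurable X]setTI.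
  exact: (measurable_symbol k).
apply/seteqP; split => [s h|s [/= sk h] i].
  by split => [|i iJ]; apply: h; rewrite inE ?eqxx// iJ orbT.
by rewrite inE => /predU1P[->//|/h].
Qed.

(** Uniqueness of measures on a generating class stable under intersection. The empty set joins the
    cylinders because conflicting prescriptions have empty intersection. *)
Lemma cylinder_measure_unique (m1 m2 : {measure set Sigma -> \bar R}) :
  (m1 setT < +oo)%E ->
  (forall J a, uniq J -> m1 (cylinder J a) = m2 (cylinder J a)) ->
  forall A, measurable A -> m1 A = m2 A.
Proof.
move=> m1oo m12 A mA.
pose G := [set A : set Sigma | A = set0 \/
  exists J a, uniq J /\ A = cylinder J a].
have GT : G setT by right; exists [::], xpredT; split => //; apply/seteqP.
apply: (g_sigma_algebra_measure_unique G _ (fun=> setT)) => //.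
- by move=> _ [->|[J [a [_ ->]]]]//; exact: measurable_cylinder.
- by rewrite bigcup_const//; exists 0%N.
- move=> _ _ [->|[J [a [uJ ->]]]] [->|[K [b [uK ->]]]];
    rewrite ?setI0 ?set0I; [by left|by left|by left|].
  have [ab|/existsNP[k /not_implyP[/andP[kJ kK] abk]]] :=
    pselect (forall k, (k \in J) && (k \in K) -> a k = b k).
    right; exists (undup (J ++ K)), (fun k => if k \in J then a k else b k).
    split; first exact: undup_uniq.
    apply/seteqP; split => [s [Js Ks] k|s h].
      by rewrite mem_undup mem_cat; case: ifPn => [/Js|_ /= /Ks].
    split => k kJ; have := h k; rewrite mem_undup mem_cat kJ ?orbT => -> //.
    by case: ifPn => // kJ'; apply: ab; rewrite kJ'.
  left; apply/seteqP; split => // s [/(_ _ kJ) sa /(_ _ kK) sb].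
  by apply: abk; rewrite -sa -sb.
- by move=> _ [->|[J [a [uJ ->]]]]; [rewrite !measure0|exact: m12].
- move: A mA; apply: sub_sigma_algebra2 => _ [k ->].
  right; exists [:: k], xpredT; split => //.
  apply/seteqP; split => [s sk i|s /(_ k)]; first by rewrite inE => /eqP ->.
  by rewrite inE eqxx => /(_ isT).
Qed.

Lemma measurable_fun_Sigma (f : Sigma -> Sigma) :
  (forall k, measurable_fun setT (fun s => f s k)) -> measurable_fun setT f.
Proof.
move=> mf; apply: (@measurability _ _ Sigma Sigma setT f symbol_events erefl).
move=> _ [_ [k ->] <-]; rewrite setTI.
have := mf k measurableT [set true] I; rewrite setTI.
by congr measurable; apply/seteqP; split.
Qed.

Definition shift (n : nat) s : Sigma := fun k => s (k + n%:Z).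

Lemma measurable_shift n : measurable_fun setT (shift n).
Proof. by apply: measurable_fun_Sigma => k; exact: (measurable_symbol (k + n%:Z)). Qed.

(** The condition [A (future s) <-> A s] expresses that [A] depends only on the symbols with
    nonnegative index. *)
Definition future s : Sigma := fun k => if 0 <= k then s k else true.

Lemma measurable_future : measurable_fun setT future.
Proof.
apply: measurable_fun_Sigma => k; rewrite /future; case: (0 <= k) => //.
exact: (measurable_symbol k).
Qed.

End cylinders.

(** * Shift invariance, and independence of past and future *)

Section bernoulli_measure.
Context (R : realType) (p : R) (P : probability Sigma R).
Hypotheses (p01 : 0 <= p <= 1) (PE : is_bernoulli_measure p P).

Lemma bernoulli_shift n (A : set Sigma) : measurable A ->
  P (shift n @^-1` A) = P A.
Proof.
move=> mA; have mS := measurable_shift n.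
pose f : {mfun Sigma >-> Sigma} := HB.pack (shift n)
  (isMeasurableFun.Build _ _ _ _ _ mS).
have := @cylinder_measure_unique _ (distribution P f) P.
apply => //.
  by rewrite (le_lt_trans (probability_le1 (distribution P f) measurableT))// ltry.
move=> J a uJ; rewrite [RHS]PE//.
pose b := fun k : int => a (k - n%:Z).
rewrite -[LHS]/(P (shift n @^-1` cylinder J a)).
have -> : shift n @^-1` cylinder J a =
          cylinder (map (fun k : int => k + n%:Z) J) b.
  apply/seteqP; split => [s h k|s h k kJ] /=.
    by move=> /mapP[i iJ ->]; rewrite /b addrK -(h i iJ).
  by rewrite /shift (h _ (map_f _ kJ)) /b (addrK n%:Z (k : int)).
rewrite [LHS]PE ?map_inj_uniq//; last exact: addIr.
by rewrite big_map; under eq_bigr do rewrite /b addrK.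
Qed.

(** For a fixed cylinder over [J], both sides are finite measures in [A] once transported by
    [future], so it is enough to compare them on cylinders. *)
Lemma bernoulli_independence (J : seq int) (a : int -> bool) (n : nat)
    (A : set Sigma) : uniq J -> (forall k, k \in J -> k < n%:Z) ->
  measurable A -> (forall s, A (future s) <-> A s) ->
  P (cylinder J a `&` shift n @^-1` A) =
    ((\prod_(k <- J) bernoulli_pmf p (a k))%:E * P A)%E.
Proof.
move=> uJ Jn mA AE; set c := \prod_(k <- J) _.
have c0 : 0 <= c by apply: prodr_ge0 => k _; exact: bernoulli_pmf_ge0.
have mC := measurable_cylinder J a.
have mfs : measurable_fun setT (future \o shift n).
  by apply: measurableT_comp; [exact: measurable_future|exact: measurable_shift].
pose m1 : {measure set Sigma -> \bar R} := pushforward (mrestr P mC) (future \o shift n).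
pose m2 : {measure set Sigma -> \bar R} :=
  mscale (NngNum c0) (pushforward P future).
have mE : m1 mfs A = m2 measurable_future A.
  apply: (@cylinder_measure_unique _ (m1 mfs) (m2 measurable_future)) => //.
    apply: (@le_lt_trans _ _ (P (cylinder J a))).
      apply: le_measure; rewrite ?inE//.
      exact: (measurableI _ _ measurableT mC).
    by rewrite (le_lt_trans (probability_le1 P mC))// ltry.
  move=> K b uK.
  rewrite -[LHS]/(P (shift n @^-1` (future @^-1` cylinder K b) `&` cylinder J a)).
  rewrite -[RHS]/(c%:E * P (future @^-1` cylinder K b))%E.
  (* [future] is [true] at negative indices, so a cylinder prescribing [false] there has empty
     preimage and both sides vanish. Otherwise only the constraints at nonnegative indices
     remain. *)
  have [[k [kK k0 bk]]|nK] := pselect (exists k, [/\ k \in K, k < 0 & b k = false]).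
    have fb s : (future s) k = true by rewrite /future leNgt k0.
    rewrite (_ : future @^-1` _ = set0).
      by rewrite preimage_set0 set0I !measure0 mule0.
    by apply/seteqP; split => // s /(_ k kK); rewrite fb bk.
  pose K' := [seq k <- K | 0 <= k].
  have futureE s : cylinder K b (future s) <-> cylinder K' b s.
    split=> [h k|h k kK].
      by rewrite mem_filter => /andP[k0 /h]; rewrite /future k0.
    rewrite /future; case: ifPn => [k0|k0].
      by apply: h; rewrite mem_filter k0.
    by apply/esym; apply: contra_notT nK => /negbTE bk; exists k; rewrite ltNge.
  rewrite (_ : future @^-1` _ = cylinder K' b); last first.
    by apply/seteqP; split => s /=; rewrite futureE.
  (* Joint prescription: [J] lies below [n] and the translate of [K'] does not, so they never
     conflict. *)
  pose ab := fun k : int => if k < n%:Z then a k else b (k - n%:Z).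
  rewrite (_ : _ `&` _ = cylinder (J ++ map (fun k : int => k + n%:Z) K') ab).
    rewrite [LHS]PE; last first.
      rewrite cat_uniq uJ map_inj_uniq ?filter_uniq ?andbT//; last exact: addIr.
      apply/hasPn => _ /mapP[k + ->]; rewrite mem_filter => /andP[k0 _].
      by apply/negP => /Jn; rewrite gtrDr ltNge k0.
    rewrite (PE b (filter_uniq _ uK)).
    rewrite big_cat/= -EFinM; congr (_ * _)%:E.
      by apply: eq_big_seq => k /Jn kn; rewrite /ab kn.
    rewrite big_map; apply: eq_big_seq => k; rewrite mem_filter => /andP[k0 _].
    by rewrite /ab gtrDr ltNge k0/= addrK.
  apply/seteqP; split => [s [hb ha] k|s h].
    rewrite mem_cat => /orP[kJ|/mapP[i iK ->]].
      by rewrite /ab (Jn _ kJ) ha.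
    move: (hb i iK) (iK); rewrite /shift mem_filter => -> /andP[i0 _].
    by rewrite /ab gtrDr ltNge i0/= addrK.
  split => [k kK|k kJ]; last by rewrite h ?mem_cat ?kJ// /ab Jn.
  move: (kK); rewrite mem_filter => /andP[k0 _].
  rewrite /shift h; last first.
    by rewrite mem_cat; apply/orP; right; apply/mapP; exists k.
  by rewrite /ab gtrDr ltNge k0/= addrK.
have AEf : future @^-1` A = A by apply/seteqP; split => s /AE.
by rewrite setIC -[in LHS]AEf -[in RHS]AEf; exact: mE.
Qed.

End bernoulli_measure.

(** * The weak law of large numbers *)

Section law_of_large_numbers.
Context (R : realType) (p : R) (P : probability Sigma R).
Hypotheses (p01 : 0 <= p <= 1) (PE : is_bernoulli_measure p P).
Implicit Types (J : seq int) (s : Sigma).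

Definition num_ones J s : R := \sum_(k <- J) (s k)%:R.

Let measurable_bit k : measurable_fun setT (fun s : Sigma => (s k)%:R : R).
Proof.
exact: (measurableT_comp (f := fun b : bool => b%:R : R) _ (measurable_symbol k)).
Qed.

Lemma measurable_num_ones J : measurable_fun setT (num_ones J).
Proof. exact: measurable_sum. Qed.

Let ones2 (k l : int) : set Sigma := [set s | s k && s l].

Let measurable_ones2 k l : measurable (ones2 k l).
Proof.
rewrite (_ : ones2 k l = cylinder [:: k; l] xpredT).
  exact: measurable_cylinder.
apply/seteqP; split => [s /andP[sk sl] i|s h].
  by rewrite !inE => /orP[]/eqP ->.
by apply/andP; split; apply: h; rewrite !inE eqxx ?orbT.
Qed.

Let prob_ones2 k l : P (ones2 k l) = (if k == l then p else p * p)%:E.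
Proof.
rewrite (_ : ones2 k l = cylinder (undup [:: k; l]) xpredT).
  rewrite [LHS]PE ?undup_uniq//= inE; case: eqP => _.
    by rewrite big_seq1.
  by rewrite big_cons big_seq1.
apply/seteqP; split => [s /andP[sk sl] i|s h].
  by rewrite mem_undup !inE => /orP[]/eqP ->.
by apply/andP; split; apply: h; rewrite mem_undup !inE eqxx ?orbT.
Qed.

Let ones2E k l s : (s k)%:R * (s l)%:R = \1_(ones2 k l) s :> R.
Proof.
rewrite indicE -natrM mulnb; congr (_%:R); congr nat_of_bool.
by apply/idP/idP => [sk|]; [exact/mem_set|rewrite inE].
Qed.

Let integral_ones2 k l :
  (\int[P]_s ((s k)%:R * (s l)%:R : R)%:E = (if k == l then p else p * p)%:E)%E.
Proof.
under eq_integral => s _ do rewrite ones2E.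
by rewrite integral_indic// setIT; exact: prob_ones2.
Qed.

Let integral_num_ones J : (\int[P]_s (num_ones J s)%:E = ((size J)%:R * p)%:E)%E.
Proof.
rewrite /num_ones; under eq_integral => s _ do rewrite -sumEFin.
rewrite ge0_integral_sum//.
  under eq_bigr => k _.
    under eq_integral => s _.
      rewrite (_ : (s k)%:R = (s k)%:R * (s k)%:R :> R); last first.
        by case: (s k); rewrite ?mulr1 ?mulr0.
      over.
    rewrite integral_ones2 eqxx; over.
  by rewrite sumEFin big_const_seq count_predT iter_addr_0 mulr_natl.
by move=> k; apply/measurable_EFinP; exact: measurable_bit.
Qed.

(** By independence an off-diagonal pair contributes [p ^+ 2]; a diagonal one exceeds this by at
    most 1, as [p <= 1]. *)
Let integral_num_ones_sqr J : uniq J ->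
  (\int[P]_s (num_ones J s ^+ 2)%:E <=
   ((size J)%:R ^+ 2 * p ^+ 2 + (size J)%:R)%:E)%E.
Proof.
move=> uJ.
have E s : ((num_ones J s ^+ 2)%:E =
    \sum_(k <- J) \sum_(l <- J) ((s k)%:R * (s l)%:R : R)%:E)%E.
  rewrite expr2 /num_ones mulr_suml -sumEFin; apply: eq_bigr => k _.
  by rewrite mulr_sumr -sumEFin.
have m2 k l : measurable_fun setT (fun s : Sigma => ((s k)%:R * (s l)%:R : R)%:E).
  by apply/measurable_EFinP; apply: measurable_funM; exact: measurable_bit.
have -> : (\int[P]_s (num_ones J s ^+ 2)%:E =
    \sum_(k <- J) \sum_(l <- J) (if k == l then p else p * p)%:E)%E.
  under eq_integral => s _ do rewrite E.
  rewrite ge0_integral_sum//; last 2 first.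
  - by move=> k; apply: emeasurable_sum => l.
  - by move=> k s _; apply: sume_ge0 => l _; rewrite lee_fin mulr_ge0.
  apply: eq_bigr => k _; rewrite ge0_integral_sum//.
  by apply: eq_bigr => l _; exact: integral_ones2.
under eq_bigr do rewrite sumEFin.
rewrite sumEFin lee_fin.
have h k : k \in J ->
    \sum_(l <- J) (if k == l then p else p * p) <= (size J)%:R * p ^+ 2 + 1.
  move=> kJ; apply: (@le_trans _ _ (\sum_(l <- J) (p ^+ 2 + (l == k)%:R))).
    apply: ler_sum => l _; rewrite eq_sym expr2; case: eqP => _; last by rewrite addr0.
    by case/andP: p01 => p0 p1; rewrite (le_trans p1)// lerDr mulr_ge0.
  rewrite big_split/= big_const_seq count_predT iter_addr_0 -[X in X + _]mulr_natl.
  rewrite lerD2l -natr_sum (_ : (\sum_(i <- J) (i == k))%N = count_mem k J).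
    by rewrite count_uniq_mem// kJ.
  by rewrite -sum1_count [RHS]big_mkcond/=; apply: eq_bigr => i _; case: (i == k).
apply: (@le_trans _ _ (\sum_(k <- J) ((size J)%:R * p ^+ 2 + 1))).
  by rewrite [leLHS]big_seq [leRHS]big_seq; apply: ler_sum => k /h.
rewrite big_const_seq count_predT iter_addr_0 mulrnDl.
by rewrite -[X in X + _]mulr_natl mulrA -expr2.
Qed.

Lemma num_ones_variance J : uniq J ->
  (\int[P]_s ((num_ones J s - (size J)%:R * p) ^+ 2)%:E <= (size J)%:R%:E)%E.
Proof.
move=> uJ; set m := (size J)%:R * p.
have m0 : 0 <= m by case/andP: p01 => p0 _; rewrite mulr_ge0.
have N0 s : 0 <= num_ones J s by apply: sumr_ge0.
have mN := measurable_num_ones J.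
set I := (\int[P]_s _)%E.
have m20 : 0 <= 2 * m by lra.
have f0 s : setT s -> (0 <= ((num_ones J s - m) ^+ 2)%:E)%E.
  by rewrite lee_fin sqr_ge0.
have mf : measurable_fun setT (fun s => ((num_ones J s - m) ^+ 2)%:E).
  by apply/measurable_EFinP; apply: measurable_funX; exact: measurable_funB.
have g0 s : setT s -> (0 <= (num_ones J s)%:E)%E by rewrite lee_fin.
have mg : measurable_fun setT (fun s => (num_ones J s)%:E).
  exact/measurable_EFinP.
have h0 s : setT s -> (0 <= (2 * m)%:E * (num_ones J s)%:E)%E.
  by rewrite -EFinM lee_fin mulr_ge0.
have mh : measurable_fun setT (fun s => (2 * m)%:E * (num_ones J s)%:E)%E.
  by apply/measurable_EFinP; exact: measurable_funM.
have k0 s : setT s -> (0 <= (num_ones J s ^+ 2)%:E)%E.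
  by rewrite lee_fin sqr_ge0.
have mk : measurable_fun setT (fun s => (num_ones J s ^+ 2)%:E).
  by apply/measurable_EFinP; exact: measurable_funX.
have c0 s : [set: Sigma] s -> (0 <= (m ^+ 2)%:E)%E by rewrite lee_fin sqr_ge0.
(* The square is expanded with the cross term moved to the left, so that all integrands are
   nonnegative. *)
have : (I + (2 * m * m)%:E <= (m ^+ 2 + (size J)%:R)%:E + (m ^+ 2)%:E)%E.
  have -> : (I + (2 * m * m)%:E =
      \int[P]_s ((num_ones J s ^+ 2)%:E + (m ^+ 2)%:E))%E.
    transitivity (\int[P]_s (((num_ones J s - m) ^+ 2)%:E +
        (2 * m)%:E * (num_ones J s)%:E))%E.
      rewrite (ge0_integralD P measurableT f0 mf h0 mh).
      rewrite (ge0_integralZl_EFin P measurableT g0 mg)//.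
      by rewrite integral_num_ones -EFinM.
    by apply: eq_integral => s _; rewrite -EFinM -!EFinD; congr (_%:E); ring.
  rewrite (ge0_integralD P measurableT k0 mk c0 (measurable_cst _)).
  rewrite integral_cst// [X in (_ * X)%E](probability_setT P) mule1 leeD2r//.
  by rewrite exprMn; exact: integral_num_ones_sqr.
have I0 : (0 <= I)%E by apply: integral_ge0 => s _; rewrite lee_fin sqr_ge0.
case: I I0 => [r| |]//= _; rewrite -!EFinD !lee_fin => h.
by nra.
Qed.

Lemma measurable_deviation J e :
  measurable [set s | (e <= `|num_ones J s - (size J)%:R * p|)%R].
Proof.
rewrite (_ : mkset _ =
    (fun s => `|num_ones J s - (size J)%:R * p|) @^-1` `[e, +oo[).
  rewrite -[X in measurable X]setTI; apply: measurableT_comp => //.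
  by apply: measurable_funB => //; exact: measurable_num_ones.
by apply/seteqP; split => s; rewrite /= in_itv/= andbT.
Qed.

(** Chebyshev's inequality. *)
Lemma num_ones_deviation J e : uniq J -> 0 < e ->
  (P [set s | (e <= `|num_ones J s - (size J)%:R * p|)%R] <=
   ((size J)%:R / e ^+ 2)%:E)%E.
Proof.
move=> uJ e0; set B := [set s | _].
have mB : measurable B by exact: measurable_deviation.
rewrite EFinM muleC lee_pdivlMl ?exprn_gt0//.
apply: le_trans (num_ones_variance uJ).
rewrite -[B]setIT -(integral_indic P measurableT mB).
have mB1 : measurable_fun setT (fun s : Sigma => (\1_B s : R)%:E).
  by apply/measurable_EFinP; exact: measurable_indic.
have B10 s : setT s -> (0 <= (\1_B s : R)%:E)%E by rewrite lee_fin.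
rewrite -(ge0_integralZl_EFin P measurableT B10 mB1) ?exprn_ge0 ?(ltW e0)//.
apply: ge0_le_integral => //.
- by move=> s _; rewrite -EFinM lee_fin mulr_ge0// exprn_ge0// ltW.
- by apply/measurable_EFinP/measurable_funM => //; exact: measurable_indic.
- apply/measurable_EFinP; apply: measurable_funX.
  by apply: measurable_funB => //; exact: measurable_num_ones.
move=> s _; rewrite -EFinM lee_fin indicE.
case: (boolP (s \in B)) => [|_]; last by rewrite mulr0 sqr_ge0.
rewrite inE mulr1 /B /= => h.
by rewrite -[leRHS]real_normK ?num_real// ler_pXn2r ?nnegrE ?(ltW e0).
Qed.

(** The observed positions [J n] may change with [n]: the same law serves initial words, windows
    around time 0 and windows in the past. *)
Lemma law_of_large_numbers (J : nat -> seq int) (x : R) :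
  (forall n, uniq (J n)) -> (size (J n))%:R / n%:R @[n --> \oo] --> x ->
  num_ones (J z.1) z.2 / z.1%:R @[z --> whp P] --> x * p.
Proof.
move=> uJ Jx.
have h0 : (num_ones (J z.1) z.2 - (size (J z.1))%:R * p) / z.1%:R
    @[z --> whp P] --> (0 : R).
  apply/cvgr0Pnorm_lt => e e0 a a0.
  have : (size (J n))%:R / n%:R / n%:R @[n --> \oo] --> (x * 0 : R).
    by apply: cvgM => //; rewrite -cvg_shiftS; exact: cvg_harmonic.
  rewrite mulr0 => /cvgr0Pnorm_lt/(_ (a * e ^+ 2)) H.
  near=> n.
  have n0 : 0 < n%:R :> R by rewrite ltr0n; near: n; exists 1.
  (* Chebyshev bounds the mass of this event by [size (J n) / (e * n) ^+ 2], which tends to 0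
     because [size (J n)] grows at most linearly. *)
  exists [set s | e * n%:R <= `|num_ones (J n) s - (size (J n))%:R * p|].
  split; first exact: measurable_deviation.
  - move=> s /negP; rewrite /= -leNgt normrM normfV (gtr0_norm n0).
    by rewrite ler_pdivlMr.
  - apply: (le_trans (num_ones_deviation (uJ n) _)); first exact: mulr_gt0.
    rewrite lee_fin ltW// exprMn invfM mulrA mulrAC ltr_pdivrMr ?exprn_gt0//.
    rewrite expr2 invfM mulrA (le_lt_trans (ler_norm _))//; near: n; apply: H.
    by rewrite mulr_gt0 ?exprn_gt0.
rewrite -[x * p]add0r.
have -> : (fun z => num_ones (J z.1) z.2 / z.1%:R) =
  (fun z => (num_ones (J z.1) z.2 - (size (J z.1))%:R * p) / z.1%:R +
    (size (J z.1))%:R / z.1%:R * p).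
  by apply/funext => z; rewrite mulrBl mulrAC subrK.
apply: cvgD => //; apply: cvgM; last exact: cvg_cst.
exact: cvg_whp Jx.
Unshelve. all: by end_near.
Qed.

End law_of_large_numbers.

(** * The coding maps *)

Section word_weight.
Context (R : realType).
Implicit Types (a b g : R) (J : seq int) (s : Sigma).

(** One product for three purposes: contraction ratio of a word ([g1], [g2]), mass of a cylinder
    ([p], [1 - p]), dyadic scale (1/2 twice). *)
Definition word_weight a b J s : R := \prod_(k <- J) (if s k then a else b).

Lemma word_weight_gt0 a b J s : 0 < a -> 0 < b -> 0 < word_weight a b J s.
Proof. by move=> a0 b0; apply: prodr_gt0 => k _; case: (s k). Qed.

Lemma ln_word_weight a b J s : 0 < a -> 0 < b ->
  ln (word_weight a b J s) = num_ones R J s * (ln a - ln b) + (size J)%:R * ln b.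
Proof.
move=> a0 b0; rewrite /word_weight /num_ones; elim: J => [|k J IH].
  by rewrite !big_nil ln1 !mul0r addr0.
rewrite !big_cons lnM ?posrE; last 2 first.
- by case: (s k).
- exact: word_weight_gt0.
by rewrite IH /= -natr1; case: (s k) => /=; ring.
Qed.

Lemma word_weight_le a b J s : 0 <= a -> 0 <= b ->
  word_weight a b J s <= Num.max a b ^+ size J.
Proof.
move=> a0 b0; have -> : Num.max a b ^+ size J = \prod_(k <- J) Num.max a b.
  by rewrite big_const_seq count_predT iter_mulr_1.
by apply: ler_prod => k _; case: (s k); rewrite ?a0 ?b0 le_max lexx ?orbT.
Qed.

(** The logarithm is affine in the number of ones, so the law of large numbers applies. *)
Lemma cvg_ln_word_weight (p : R) (P : probability Sigma R) a b
    (J : nat -> seq int) (x : R) :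
  0 <= p <= 1 -> is_bernoulli_measure p P -> 0 < a -> 0 < b ->
  (forall n, uniq (J n)) -> (size (J n))%:R / n%:R @[n --> \oo] --> x ->
  ln (word_weight a b (J z.1) z.2) / z.1%:R @[z --> whp P] --> x * mean_log p a b.
Proof.
move=> p01 PE a0 b0 uJ Jx.
have -> : x * mean_log p a b = x * p * (ln a - ln b) + x * ln b.
  by rewrite /mean_log; ring.
have -> : (fun z => ln (word_weight a b (J z.1) z.2) / z.1%:R) =
  (fun z => num_ones R (J z.1) z.2 / z.1%:R * (ln a - ln b) +
     (size (J z.1))%:R / z.1%:R * ln b).
  by apply/funext => z; rewrite ln_word_weight//; ring.
apply: cvgD.
  apply: cvgM; first exact: law_of_large_numbers.
  exact: cvg_cst.
apply: cvgM; last exact: cvg_cst.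
exact: (@cvg_whp _ _ _ P _ _ _ Jx).
Qed.

Lemma bernoulli_cylinder (p : R) (P : probability Sigma R) J s :
  is_bernoulli_measure p P -> uniq J ->
  P (cylinder J s) = (word_weight p (1 - p) J s)%:E.
Proof. by move=> PE uJ; rewrite [LHS]PE. Qed.

Definition first n : seq int := [seq k%:Z | k <- iota 0 n].

Lemma size_first n : size (first n) = n.
Proof. by rewrite size_map size_iota. Qed.

Lemma mem_first n k : (k \in first n) = (0 <= k < n%:Z).
Proof.
apply/mapP/idP => [[i + ->]|]; first by rewrite mem_iota.
by case: k => // i /andP[_ i_n]; exists i => //; rewrite mem_iota.
Qed.

Lemma uniq_first n : uniq (first n).
Proof. by rewrite map_inj_uniq ?iota_uniq// => i j []. Qed.

Lemma word_weight_firstS a b n s : word_weight a b (first n.+1) s =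
  (if s 0 then a else b) * word_weight a b (first n) (shift 1 s).
Proof.
rewrite /word_weight /first /= big_cons; congr (_ * _).
rewrite (iotaDl 1 0) -map_comp !big_map; apply: eq_bigr => i _.
by rewrite /shift /= addrC.
Qed.

Lemma shiftS n s : shift n.+1 s = shift n (shift 1 s).
Proof. by apply/funext => k; rewrite /shift -addrA intS [1 + _]addrC. Qed.

Lemma shift_first n s i : shift n s i%:Z = s (n + i)%N%:Z.
Proof. by rewrite /shift addrC -PoszD. Qed.

End word_weight.

Section coding_recursion.
Context (R : realType) (g1 g2 : R).
Hypotheses (g1_01 : 0 < g1 < 1) (g2_01 : 0 < g2 < 1).
Implicit Types (s : Sigma) (n : nat).

Let g1_gt0 : 0 < g1. Proof. by case/andP: g1_01. Qed.
Let g1_lt1 : g1 < 1. Proof. by case/andP: g1_01. Qed.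
Let g2_gt0 : 0 < g2. Proof. by case/andP: g2_01. Qed.
Let g2_lt1 : g2 < 1. Proof. by case/andP: g2_01. Qed.

Definition pi_hat_partial n s : R :=
  \sum_(0 <= k < n) letter (s k%:Z) * word_weight g1 g2 (first k.+1) s.

Let term s k : R := letter (s k%:Z) * word_weight g1 g2 (first k.+1) s.

Let termE s k :
  letter (s k%:Z) * g2 ^+ num_minus s k * g1 ^+ num_plus s k = term s k.
Proof.
rewrite pow_num_minusE pow_num_plusE -mulrA -big_split/=; congr (_ * _).
rewrite /word_weight /first big_map -[iota 0 _]/(index_iota 0 k.+1) big_mkord.
by apply: eq_bigr => i _; case: (s _); rewrite ?mul1r ?mulr1.
Qed.

Let pi_hat_partialS n s : pi_hat_partial n.+1 s =
  (if s 0 then g1 else g2) * (letter (s 0) + pi_hat_partial n (shift 1 s)).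
Proof.
rewrite /pi_hat_partial big_nat_recl// mulrDr mulr_sumr; congr (_ + _).
  by rewrite /term /word_weight /first /= big_seq1 mulrC.
apply: eq_bigr => k _; rewrite word_weight_firstS shift_first add1n.
by rewrite mulrCA.
Qed.

Let is_cvg_pi_hat_partial s : cvgn (pi_hat_partial ^~ s).
Proof.
pose g := Num.max g1 g2.
have g0 : 0 < g by rewrite lt_max g1_gt0.
have g_lt1 : g < 1 by rewrite gt_max g1_lt1.
apply: (@normed_cvg _ _ (term s)).
apply: (@series_le_cvg _ _ (geometric g g)) => [k|k|k|].
- exact: normr_ge0.
- by rewrite /= mulr_ge0 ?exprn_ge0// ltW.
- rewrite /= /term normrM.
  have -> : `|letter (s k%:Z) : R| = 1.
    by rewrite /letter; case: (s _); rewrite ?normrN normr1.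
  rewrite mul1r gtr0_norm ?word_weight_gt0// -exprS -[k.+1 in leRHS]size_first.
  by apply: word_weight_le; rewrite ltW.
- by apply: is_cvg_geometric_series; rewrite gtr0_norm.
Qed.

Lemma cvg_pi_hat_partial s : pi_hat_partial ^~ s @ \oo --> pi_hat g1 g2 s.
Proof.
have -> : pi_hat g1 g2 s = limn (pi_hat_partial ^~ s).
  by congr (limn _); apply/funext => n; apply: eq_bigr => k _; rewrite termE.
exact: is_cvg_pi_hat_partial.
Qed.

Let pi_hatE s : pi_hat g1 g2 s =
  (if s 0 then g1 else g2) * (letter (s 0) + pi_hat g1 g2 (shift 1 s)).
Proof.
have := @cvg_pi_hat_partial s; rewrite -cvg_shiftS => /cvg_lim <-//.
apply/cvg_lim => //=.
under eq_fun do rewrite pi_hat_partialS.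
apply: cvgM; first exact: cvg_cst.
by apply: cvgD; [exact: cvg_cst|exact: cvg_pi_hat_partial].
Qed.

Let lo := - g2 / (1 - g2).
Let hi := g1 / (1 - g1).

(** [lo] and [hi] are the fixed points of [u |-> g2 * (u - 1)] and [u |-> g1 * (u + 1)], so the
    recursion keeps all partial sums between them. *)
Let pi_hat_bounds s : lo <= pi_hat g1 g2 s <= hi.
Proof.
have lo1 : lo * (1 - g2) = - g2 by rewrite /lo divfK// subr_eq0 gt_eqF.
have hi1 : hi * (1 - g1) = g1 by rewrite /hi divfK// subr_eq0 gt_eqF.
have lo0 : lo < 0 by rewrite /lo mulNr oppr_lt0 divr_gt0// subr_gt0.
have hi0 : 0 < hi by rewrite /hi divr_gt0// subr_gt0.
have h n : forall s', lo <= pi_hat_partial n s' <= hi.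
  elim: n => [|n IH] s'; first by rewrite /pi_hat_partial big_geq// !ltW.
  rewrite pi_hat_partialS /letter; have /andP[l h] := IH (shift 1 s').
  move: g1_gt0 g1_lt1 g2_gt0 g2_lt1 => *.
  by case: (s' 0); apply/andP; split; nra.
rewrite -(cvg_lim _ (@cvg_pi_hat_partial s))//; apply/andP; split.
  apply: limr_ge; first exact: is_cvg_pi_hat_partial.
  by apply: nearW => n; case/andP: (h n s).
apply: limr_le; first exact: is_cvg_pi_hat_partial.
by apply: nearW => n; case/andP: (h n s).
Qed.

Let lo_lt_hi : lo < hi.
Proof.
rewrite (@lt_trans _ _ 0)//; first by rewrite /lo mulNr oppr_lt0 divr_gt0// subr_gt0.
by rewrite /hi divr_gt0// subr_gt0.
Qed.

(** The normalization carries the fixed points [hi] and [lo] to 1 and -1, so the branches become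
    contractions of [-1, 1] fixing an end point, as in the fibres of the system. *)
Lemma pi1_rec s : pi1 g1 g2 s =
  if s 0 then g1 * pi1 g1 g2 (shift 1 s) + (1 - g1)
  else g2 * pi1 g1 g2 (shift 1 s) - (1 - g2).
Proof.
rewrite /pi1 /affine_normalization pi_hatE -/lo -/hi /letter.
have lo1 : lo * (1 - g2) = - g2 by rewrite /lo divfK// subr_eq0 gt_eqF.
have hi1 : hi * (1 - g1) = g1 by rewrite /hi divfK// subr_eq0 gt_eqF.
have d0 : hi - lo != 0 by rewrite subr_eq0 gt_eqF.
have E u : (2 * (u - lo) / (hi - lo) - 1) * (hi - lo) = 2 * (u - lo) - (hi - lo).
  by rewrite mulrBl divfK// mul1r.
have E' c u : c * (2 * (u - lo) / (hi - lo) - 1) * (hi - lo) =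
    c * (2 * (u - lo) - (hi - lo)) by rewrite -mulrA E.
apply: (mulIf d0); rewrite E; set t := pi_hat _ _ _.
by case: (s 0) => /=; [rewrite [RHS]mulrDl|rewrite [RHS]mulrBl]; rewrite E';
  move: lo1 hi1; lra.
Qed.

Lemma pi1_bounds s : -1 <= pi1 g1 g2 s <= 1.
Proof.
have /andP[l h] := pi_hat_bounds s.
have d0 : 0 < hi - lo by rewrite subr_gt0.
rewrite /pi1 /affine_normalization -/lo -/hi; apply/andP; split.
  by rewrite lerBrDr addNr divr_ge0// ?(ltW d0)// mulr_ge0// subr_ge0.
rewrite lerBlDr ler_pdivrMr//; lra.
Qed.

(** A common word applies the same composition of branches to both tails, an affine map whose ratio
    is the weight of the word. *)
Lemma pi1_agree n s s' : (forall i, (i < n)%N -> s i%:Z = s' i%:Z) ->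
  pi1 g1 g2 s - pi1 g1 g2 s' = word_weight g1 g2 (first n) s *
    (pi1 g1 g2 (shift n s) - pi1 g1 g2 (shift n s')).
Proof.
elim: n s s' => [|n IH] s s' ss'.
  rewrite /word_weight big_nil mul1r.
  by congr (pi1 _ _ _ - pi1 _ _ _); apply/funext => k; rewrite /shift addr0.
rewrite word_weight_firstS (shiftS n s) (shiftS n s') -mulrA -IH => [|i i_n]; last first.
  by rewrite !shift_first !add1n ss'.
rewrite pi1_rec [in X in _ - X]pi1_rec -(ss' 0%N)//.
by case: (s 0); ring.
Qed.

Lemma word_weight_le1 J s : word_weight g1 g2 J s <= 1.
Proof.
rewrite /word_weight; apply: prodr_ile1 => k _.
by case: (s k); rewrite !ltW.
Qed.

(* The images of [-1, 1] under the two branches are at distance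
   2 (1 - g1 - g2). *)
Lemma pi1_separation n s s' : g1 + g2 < 1 ->
  `|pi1 g1 g2 s - pi1 g1 g2 s'| <
    word_weight g1 g2 (first n) s * (2 * (1 - g1 - g2)) ->
  forall i, (i < n)%N -> s i%:Z = s' i%:Z.
Proof.
move=> g12; elim: n s s' => // n IH s s'.
have W0 : 0 < word_weight g1 g2 (first n) (shift 1 s).
  exact: word_weight_gt0.
have W1 := word_weight_le1 (first n) (shift 1 s).
have c0 : 0 < 2 * (1 - g1 - g2) by lra.
rewrite word_weight_firstS pi1_rec [in X in _ - X]pi1_rec.
set x := pi1 _ _ _; set y := pi1 _ _ (shift 1 s').
have [ss0|ss0] := eqVneq (s 0) (s' 0).
  move=> h [_|i]; first by rewrite ss0.
  rewrite ltnS => i_n; rewrite -add1n -!shift_first; apply: (IH) i_n.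
  have v0 : 0 < if s 0 then g1 else g2 by case: (s 0).
  rewrite -(ltr_pM2l v0) mulrA; apply: le_lt_trans h.
  rewrite -[X in X * _](gtr0_norm v0) -normrM -/x -/y -ss0.
  by rewrite le_eqVlt; apply/orP; left; case: (s 0);
    apply/eqP; congr Num.norm; ring.
have /andP[x1 x2] : -1 <= x <= 1 := pi1_bounds _.
have /andP[y1 y2] : -1 <= y <= 1 := pi1_bounds _.
set W := word_weight _ _ _ _ in W0 W1 *.
have vW v : 0 < v -> v < 1 -> v * W * (2 * (1 - g1 - g2)) <= 2 * (1 - g1 - g2).
  by move=> v0 v1; rewrite ler_piMl ?(ltW c0)// mulr_ile1 ?(ltW v0) ?(ltW v1) ?(ltW W0).
have g1x : 0 <= g1 * (x + 1) by rewrite mulr_ge0 ?(ltW g1_gt0)// -lerBlDr sub0r.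
have g2x : 0 <= g2 * (1 - x) by rewrite mulr_ge0 ?(ltW g2_gt0)// subr_ge0.
have g1y : 0 <= g1 * (y + 1) by rewrite mulr_ge0 ?(ltW g1_gt0)// -lerBlDr sub0r.
have g2y : 0 <= g2 * (1 - y) by rewrite mulr_ge0 ?(ltW g2_gt0)// subr_ge0.
case: (s 0) (s' 0) ss0 => [] [] //= _; rewrite ltNge => /negP[];
  (apply: le_trans (vW _ _ _) _ => //); rewrite ler_normr; apply/orP.
- by left; lra.
- by right; lra.
Qed.

End coding_recursion.

(** * The first coordinate as a dyadic line coding *)

Section past_coding.
Context (R : realType).
Implicit Types (s : Sigma) (n m : nat).

Let h : R := 2^-1.
Let h01 : 0 < h < 1.
Proof. by rewrite invr_gt0 invf_lt1 ?ltr1n ?ltr0n. Qed.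

Definition reflect s : Sigma := fun k => s (- (k + 1)).

Lemma word_weight_half J s : word_weight h h J s = h ^+ size J.
Proof.
rewrite /word_weight; under eq_bigr do rewrite if_same.
by rewrite big_const_seq count_predT iter_mulr_1.
Qed.

(** With both ratios 1/2 the interval is already [-1, 1] and the normalization is the identity, so
    the results on [pi1] apply to the past read backwards. *)
Lemma past_pi1 s : past s = pi1 h h (reflect s) :> R.
Proof.
have hE : 1 - h = h by rewrite /h; lra.
have h0 : h != 0 by rewrite /h invr_eq0.
rewrite /pi1 /affine_normalization hE mulNr divff// opprK.
have -> : 1 + 1 = 2 :> R by [].
rewrite mulrAC divff// mul1r addrK.
rewrite /past; apply/cvg_lim => //.
rewrite -cvg_shiftS.
rewrite (_ : [sequence _]_n = pi_hat_partial h h ^~ (reflect s)).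
  exact: cvg_pi_hat_partial.
apply/funext => n /=; rewrite big_add1/= /pi_hat_partial.
apply: eq_bigr => k _; rewrite word_weight_half size_first exprVn.
by rewrite /reflect [_ + 1]addrC -intS.
Qed.

Let pi1_half_rec s : pi1 h h s = (letter (s 0) + pi1 h h (shift 1 s)) / 2.
Proof. by rewrite pi1_rec// /letter /h; case: (s 0); lra. Qed.

(** The extreme case has the symbol -1 at all indices other than [i]. *)
Let pi1_half_lower i s : s i%:Z -> -1 + 2 * h ^+ i.+1 <= pi1 h h s.
Proof.
elim: i s => [|i IH] s si; rewrite pi1_half_rec /letter.
  rewrite si; have /andP[x1 _] := pi1_bounds h01 h01 (shift 1 s).
  by rewrite /h expr1; lra.
have := IH (shift 1 s); rewrite shift_first add1n => /(_ si).
rewrite [h ^+ i.+2]exprS; set y := h ^+ i.+1; rewrite /h.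
by case: (s 0); lra.
Qed.

Let pi1_half_upper i s : ~~ s i%:Z -> pi1 h h s <= 1 - 2 * h ^+ i.+1.
Proof.
elim: i s => [|i IH] s si; rewrite pi1_half_rec /letter.
  rewrite (negbTE si); have /andP[_ x1] := pi1_bounds h01 h01 (shift 1 s).
  by rewrite /h expr1; lra.
have := IH (shift 1 s); rewrite shift_first add1n => /(_ si).
rewrite [h ^+ i.+2]exprS; set y := h ^+ i.+1; rewrite /h.
by case: (s 0); lra.
Qed.

(* Dyadic intervals are adjacent, but a point whose digits are not all equal
   between the times m and N is far from the ends of its interval of order m. *)
Lemma pi1_half_separation m N i j s s' :
  (m <= i < N)%N -> (m <= j < N)%N -> s i%:Z -> ~~ s j%:Z ->
  `|pi1 h h s - pi1 h h s'| < h ^+ N ->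
  forall k, (k < m)%N -> s k%:Z = s' k%:Z.
Proof.
elim: m N i j s s' => // m IH [|N] [|i] [|j] s s' //; rewrite ?ltn0 ?andbF//.
rewrite !ltnS => iN jN si sj; rewrite pi1_half_rec [pi1 h h s']pi1_half_rec.
set x := pi1 _ _ _; set y := pi1 _ _ (shift 1 s').
have hN : 0 < h ^+ N by rewrite exprn_gt0//; case/andP: h01.
rewrite exprS; have [ss0|ss0] := eqVneq (s 0) (s' 0).
  rewrite -ss0 -mulrBl [_ - _](_ : _ = x - y); last by ring.
  rewrite normrM normfV [`|2|]gtr0_norm// mulrC.
  rewrite ltr_pM2l ?invr_gt0// => xy [_|k]; first by rewrite ss0.
  rewrite ltnS => km; rewrite -add1n -!shift_first.
  by apply: (IH N i j) km; rewrite // shift_first add1n.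
have /andP[x1 x2] : -1 <= x <= 1 := pi1_bounds h01 h01 _.
have /andP[y1 y2] : -1 <= y <= 1 := pi1_bounds h01 h01 _.
have hn k : (k < N)%N -> h ^+ N <= h ^+ k.+1.
  by move=> kN; rewrite ler_wiXn2l// ?ltW//; case/andP: h01.
(* The first symbols differ here. The symbols at [i] and [j] keep [x] at distance [2 * h ^+ N] from
   both ends of [-1, 1], so the images are at least [h ^+ N] apart, twice the allowed distance. *)
have xl : -1 + 2 * h ^+ N <= x.
  apply: le_trans (@pi1_half_lower i _ _); last by rewrite shift_first add1n.
  by rewrite lerD2l ler_pM2l// hn//; case/andP: iN.
have xu : x <= 1 - 2 * h ^+ N.
  apply: le_trans (@pi1_half_upper j _ _) _; first by rewrite shift_first add1n.
  by rewrite lerD2l lerN2 ler_pM2l// hn//; case/andP: jN.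
have hE : h * h ^+ N = h ^+ N / 2 by rewrite mulrC.
rewrite hE ltNge => /negP[]; rewrite /letter ler_normr; apply/orP.
by case: (s 0) (s' 0) ss0 => [] [] //= _; [left|right]; lra.
Qed.

End past_coding.

(** * Masses of balls *)

Section euclidean_balls.
Context (R : realType) (q : nat).
Implicit Types (x y : q.-tuple R) (e : R).

Let sqdist x y : R := \sum_(i < q) (tnth y i - tnth x i) ^+ 2.

Lemma euclidean_ball_coord x y e : euclidean_ball x e y ->
  forall i, `|tnth y i - tnth x i| < e.
Proof.
move=> xy i; apply: le_lt_trans xy.
rewrite -sqrtr_sqr ler_wsqrtr// (bigD1 i)//= lerDl.
by apply: sumr_ge0 => j _; exact: sqr_ge0.
Qed.

(** The sum of squares is at most [3 * (e / 2) ^+ 2], which is below [e ^+ 2]. *)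
Lemma coord_euclidean_ball x y e : (q <= 3)%N -> 0 < e ->
  (forall i, `|tnth y i - tnth x i| < e / 2) -> euclidean_ball x e y.
Proof.
move=> q3 e0 xy; rewrite /euclidean_ball /= -[ltRHS]gtr0_norm// -sqrtr_sqr.
rewrite ltr_sqrt ?exprn_gt0//.
have : \sum_(i < q) (tnth y i - tnth x i) ^+ 2 <= \sum_(i < q) (e / 2) ^+ 2.
  apply: ler_sum => i _; rewrite -real_normK ?num_real//.
  by rewrite ler_pXn2r ?nnegrE ?divr_ge0 ?(ltW e0)// ltW.
move=> /le_lt_trans; apply; rewrite sumr_const card_ord -mulr_natl.
have q3' : (q%:R <= 3 :> R) by rewrite ler_nat.
have : 0 < e ^+ 2 by rewrite exprn_gt0.
by rewrite exprMn; move: (e ^+ 2) => f f0; rewrite expr2; nra.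
Qed.

Let balls e : set (q.-tuple R * q.-tuple R) :=
  [set z | euclidean_ball z.1 e z.2].

Let measurable_balls e : measurable (balls e).
Proof.
have mf : measurable_fun setT (fun z : q.-tuple R * q.-tuple R =>
    Num.sqrt (sqdist z.1 z.2)).
  apply: measurableT_comp.
    exact: (continuous_measurable_fun (@sqrt_continuous R)).
  apply: measurable_sum => i; apply: measurable_funX; apply: measurable_funB.
    exact: (measurableT_comp (measurable_tnth i) measurable_snd).
  exact: (measurableT_comp (measurable_tnth i) measurable_fst).
have := measurable_fun_ltr mf (measurable_cst e).
by move=> /(_ measurableT [set true] I); rewrite setTI preimage_true.
Qed.

Let xsection_balls x e : xsection (balls e) x = euclidean_ball x e.
Proof. by apply/seteqP; split => y; rewrite xsectionP. Qed.

Lemma measurable_euclidean_ball x e : measurable (euclidean_ball x e).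
Proof. by rewrite -xsection_balls; exact: measurable_xsection. Qed.

(** Balls are sections of the measurable set [balls e], and masses of sections depend measurably on
    the base point. [ae_cvg_whp] needs this. *)
Lemma measurable_ball_measure (nu : probability (q.-tuple R) R) e :
  measurable_fun setT (fun x => nu (euclidean_ball x e)).
Proof.
under eq_fun do rewrite -xsection_balls.
exact: (measurable_fun_xsection nu (measurable_balls e)).
Qed.

End euclidean_balls.

(** * Comparison of balls with cylinders *)

Section ball_estimates.
Context (R : realType).
Implicit Types (s : Sigma) (g e : R) (J : seq int).

Lemma word_weight_first_cvg0 g1 g2 C e s : 0 < g1 < 1 -> 0 < g2 < 1 -> 0 < e ->
  0 < C -> \forall n \near \oo, C * word_weight g1 g2 (first n) s < e.
Proof.
move=> /andP[g10 g11] /andP[g20 g21] e0 C0; pose g := Num.max g1 g2.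
have g0 : 0 < g by rewrite lt_max g10.
have g_lt1 : g < 1 by rewrite gt_max g11.
have /cvgr0Pnorm_lt/(_ (e / C)) : g ^+ n @[n --> \oo] --> 0.
  by apply: cvg_expr; rewrite gtr0_norm.
rewrite divr_gt0// => /(_ isT); apply: filterS => n.
rewrite gtr0_norm ?exprn_gt0// ltr_pdivlMr// mulrC; apply: le_lt_trans.
rewrite ler_pM2l// -[n in leRHS]size_first.
by apply: word_weight_le; rewrite ltW.
Qed.

Lemma pi_line_ball g1 g2 s s' e : euclidean_ball (pi_line g1 g2 s) e
  (pi_line g1 g2 s') <-> `|pi1 g1 g2 s' - pi1 g1 g2 s| < e.
Proof.
rewrite /euclidean_ball /= big_ord1 sqrtr_sqr.
by rewrite !(tnth_nth 0).
Qed.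

Definition before m : seq int := [seq - (k.+1)%:Z | k <- iota 0 m].

Lemma past_agree m s s' : (forall k, k \in before m -> s k = s' k) ->
  forall i, (i < m)%N -> reflect s i%:Z = reflect s' i%:Z.
Proof.
move=> ss' i im; rewrite /reflect addrC -intS; apply: ss'.
by apply/mapP; exists i => //; rewrite mem_iota.
Qed.

Lemma cube_ball_coord b1 b2 t1 t2 s s' e :
  euclidean_ball (pi_cube b1 b2 t1 t2 s) e (pi_cube b1 b2 t1 t2 s') ->
  [/\ `|past s' - past s| < e, `|pi1 b1 b2 s' - pi1 b1 b2 s| < e &
      `|pi1 t1 t2 s' - pi1 t1 t2 s| < e].
Proof.
move=> /euclidean_ball_coord h; split.
- by have := h ord0; rewrite !(tnth_nth 0).
- by have := h (Ordinal (isT : (1 < 3)%N)); rewrite !(tnth_nth 0).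
- by have := h (Ordinal (isT : (2 < 3)%N)); rewrite !(tnth_nth 0).
Qed.

Lemma coord_cube_ball b1 b2 t1 t2 s s' e : 0 < e ->
  `|past s' - past s| < e / 2 -> `|pi1 b1 b2 s' - pi1 b1 b2 s| < e / 2 ->
  `|pi1 t1 t2 s' - pi1 t1 t2 s| < e / 2 ->
  euclidean_ball (pi_cube b1 b2 t1 t2 s) e (pi_cube b1 b2 t1 t2 s').
Proof.
move=> e0 h1 h2 h3; apply: coord_euclidean_ball => //.
by case=> [[|[|[|//]]]] i; rewrite !(tnth_nth 0).
Qed.

(** The factor 2 is the length of [-1, 1], which contains both tails. *)
Lemma pi1_agree_dist g1 g2 n s s' : 0 < g1 < 1 -> 0 < g2 < 1 ->
  (forall k, k \in first n -> s k = s' k) ->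
  `|pi1 g1 g2 s' - pi1 g1 g2 s| <= 2 * word_weight g1 g2 (first n) s.
Proof.
move=> g1_01 g2_01 ss'; rewrite distrC (@pi1_agree _ _ _ _ _ n)//; last first.
  by move=> i i_n; apply: ss'; rewrite mem_first.
have W0 : 0 < word_weight g1 g2 (first n) s.
  by apply: word_weight_gt0; [case/andP: g1_01|case/andP: g2_01].
rewrite normrM gtr0_norm// mulrC ler_pM2r//.
have /andP[x1 x2] := pi1_bounds g1_01 g2_01 (shift n s).
have /andP[y1 y2] := pi1_bounds g1_01 g2_01 (shift n s').
by rewrite ler_norml; apply/andP; split; lra.
Qed.

Lemma past_agree_dist m s s' : (forall k, k \in before m -> s k = s' k) ->
  `|past s' - past s| <= 2 * 2^-1 ^+ m :> R.
Proof.
have h01 : 0 < (2^-1 : R) < 1 by rewrite invr_gt0 invf_lt1 ?ltr1n ?ltr0n.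
move=> /past_agree ss'; rewrite !past_pi1.
rewrite -[in leRHS](size_first m) -(@word_weight_half _ (first m) (reflect s)).
apply: pi1_agree_dist => // k; rewrite mem_first.
by case: k => // k /andP[_]; exact: ss'.
Qed.

Lemma mem_before m k : (k \in before m) = (- m%:Z <= k < 0).
Proof.
apply/mapP/idP => [[i + ->]|/andP[mk k0]].
  by rewrite mem_iota => im; lia.
exists (absz k).-1; first by rewrite mem_iota; lia.
by lia.
Qed.

Definition around m n : seq int := before m ++ first n.

Lemma size_around m n : size (around m n) = (m + n)%N.
Proof. by rewrite size_cat size_map size_iota size_first. Qed.

Lemma uniq_around m n : uniq (around m n).
Proof.
rewrite cat_uniq uniq_first andbT map_inj_uniq ?iota_uniq//=; last first.
  by move=> i j /oppr_inj[].
by apply/hasPn => k; rewrite mem_before mem_first => /andP[k0 _]; lia.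
Qed.

Lemma around_lt m n k : k \in around m n -> k < n%:Z.
Proof.
rewrite mem_cat mem_before mem_first => /orP[/andP[_ k0]|/andP[_ //]].
exact: lt_le_trans k0 _.
Qed.

Lemma reflect_before m k : k \in before m ->
  exists2 i, (i < m)%N & forall s, s k = reflect s i%:Z.
Proof.
move=> /mapP[i + ->]; rewrite mem_iota => im; exists i => // s.
by rewrite /reflect addrC -intS.
Qed.

Variables (p : R) (P : probability Sigma R).
Hypotheses (p_01 : 0 < p < 1) (PE : is_bernoulli_measure p P).

Let p01 : 0 <= p <= 1.
Proof. by case/andP: p_01 => p0 p1; rewrite !ltW. Qed.

Lemma cylinder_weight_gt0 J s : 0 < word_weight p (1 - p) J s.
Proof. by case/andP: p_01 => p0 p1; apply: word_weight_gt0; rewrite ?subr_gt0. Qed.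

Section line.
Variables (g1 g2 : R).
Hypotheses (g1_01 : 0 < g1 < 1) (g2_01 : 0 < g2 < 1).

Definition line_mass s e : R :=
  fine (distribution P (pi_line g1 g2) (euclidean_ball (pi_line g1 g2 s) e)).

Lemma line_massE s e : (line_mass s e)%:E =
  P [set s' | `|pi1 g1 g2 s' - pi1 g1 g2 s| < e].
Proof.
rewrite fineK; last first.
  by apply: fin_num_measure; exact: measurable_euclidean_ball.
by congr (P _); apply/seteqP; split => s' /pi_line_ball.
Qed.

Lemma measurable_line_ball s e :
  measurable [set s' | `|pi1 g1 g2 s' - pi1 g1 g2 s| < e].
Proof.
have mb := measurable_euclidean_ball (pi_line g1 g2 s) e.
have := measurable_funPTI (pi_line g1 g2) mb.
by congr measurable; apply/seteqP; split => s' /pi_line_ball.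
Qed.

Lemma line_mass_lower s n e :
  2 * word_weight g1 g2 (first n) s < e ->
  word_weight p (1 - p) (first n) s <= line_mass s e.
Proof.
move=> We; rewrite -lee_fin line_massE -(bernoulli_cylinder _ PE (uniq_first n)).
apply: le_measure; rewrite ?inE; [exact: measurable_cylinder| |].
  exact: measurable_line_ball.
move=> s' ss'; apply: le_lt_trans We; apply: pi1_agree_dist => // k kn.
by rewrite ss'.
Qed.

(** Below the separation scale of words of length [n], every sequence coded into the ball shares the
    first [n] symbols of [s]. *)
Lemma line_mass_upper s n e : g1 + g2 < 1 ->
  e <= word_weight g1 g2 (first n) s * (2 * (1 - g1 - g2)) ->
  line_mass s e <= word_weight p (1 - p) (first n) s.
Proof.
move=> g12 eW; rewrite -lee_fin line_massE -(bernoulli_cylinder _ PE (uniq_first n)).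
apply: le_measure; rewrite ?inE; [|exact: measurable_cylinder|].
  exact: measurable_line_ball.
move=> s' /= ss' k; rewrite mem_first; case: k => // k /andP[_ kn].
apply/esym; apply: (pi1_separation g1_01 g2_01 g12) kn.
by rewrite distrC (lt_le_trans ss').
Qed.

(** The ball contains the image of a cylinder. Positivity at every [s] keeps [ln] away from its
    default value at 0. *)
Lemma line_mass_gt0 s e : 0 < e -> 0 < line_mass s e.
Proof.
move=> e0; have /filter_ex[n We] :=
  word_weight_first_cvg0 s g1_01 g2_01 e0 (ltr0Sn _ 1).
exact: lt_le_trans (cylinder_weight_gt0 _ _) (line_mass_lower We).
Qed.

Lemma line_mass_le1 s e : line_mass s e <= 1.
Proof.
by rewrite -lee_fin line_massE probability_le1//; exact: measurable_line_ball.
Qed.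

End line.

Section cube.
Variables (b1 b2 t1 t2 : R).
Hypotheses (b1_01 : 0 < b1 < 1) (b2_01 : 0 < b2 < 1).
Hypotheses (t1_01 : 0 < t1 < 1) (t2_01 : 0 < t2 < 1).

Definition cube_mass s e : R :=
  fine (distribution P (pi_cube b1 b2 t1 t2)
    (euclidean_ball (pi_cube b1 b2 t1 t2 s) e)).

Let cube_ball s e : set Sigma :=
  pi_cube b1 b2 t1 t2 @^-1` euclidean_ball (pi_cube b1 b2 t1 t2 s) e.

Let measurable_cube_ball s e : measurable (cube_ball s e).
Proof.
exact: (measurable_funPTI (pi_cube b1 b2 t1 t2)
  (measurable_euclidean_ball (pi_cube b1 b2 t1 t2 s) e)).
Qed.

Let cube_massE s e : (cube_mass s e)%:E = P (cube_ball s e).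
Proof.
by rewrite fineK//; apply: fin_num_measure; exact: measurable_euclidean_ball.
Qed.

Let split_mass s m n r :
  (word_weight p (1 - p) (around m n) s * line_mass b1 b2 (shift n s) r)%:E =
  P (cylinder (around m n) s `&`
     shift n @^-1` [set s' | `|pi1 b1 b2 s' - pi1 b1 b2 (shift n s)| < r]).
Proof.
(* The condition on [future] closes by computation, since [pi1] reads only symbols with natural
   index. *)
rewrite (bernoulli_independence p01 PE)//.
- by rewrite EFinM line_massE.
- exact: uniq_around.
- exact: around_lt.
- exact: measurable_line_ball.
Qed.

Let measurable_split s m n r : measurable (cylinder (around m n) s `&`
  shift n @^-1` [set s' | `|pi1 b1 b2 s' - pi1 b1 b2 (shift n s)| < r]).
Proof.
apply: measurableI; first exact: measurable_cylinder.
rewrite -[X in measurable X]setTI; apply: measurable_shift => //.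
exact: measurable_line_ball.
Qed.

Let agree_around m n s s' : cylinder (around m n) s s' ->
  (forall k, k \in before m -> s k = s' k) /\
  (forall k, k \in first n -> s k = s' k).
Proof. by move=> h; split => k kJ; rewrite h ?mem_cat ?kJ ?orbT. Qed.

Let shift_dist n s s' : (forall k, k \in first n -> s k = s' k) ->
  `|pi1 b1 b2 s' - pi1 b1 b2 s| = word_weight b1 b2 (first n) s *
    `|pi1 b1 b2 (shift n s') - pi1 b1 b2 (shift n s)|.
Proof.
move=> ss'; rewrite distrC (@pi1_agree _ _ _ b1_01 b2_01 n s s'); last first.
  by move=> i i_n; apply: ss'; rewrite mem_first.
rewrite normrM gtr0_norm 1?distrC//.
by apply: word_weight_gt0; [case/andP: b1_01|case/andP: b2_01].
Qed.

(** One inequality per coordinate: on the cylinder the past symbols control the first and the word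
    weight the third, while the second is a contracted copy of the line coordinate of the shifted
    sequence. *)
Lemma cube_mass_lower s m n e r : 0 < e ->
  2 * 2^-1 ^+ m < e / 2 -> 2 * word_weight t1 t2 (first n) s < e / 2 ->
  word_weight b1 b2 (first n) s * r <= e / 2 ->
  word_weight p (1 - p) (around m n) s * line_mass b1 b2 (shift n s) r <=
    cube_mass s e.
Proof.
move=> e0 me te be; rewrite -lee_fin cube_massE split_mass.
apply: le_measure; rewrite ?inE; [exact: measurable_split|by []|].
move=> s' [/agree_around[sm sn] sr]; apply: coord_cube_ball => //.
- exact: le_lt_trans (past_agree_dist sm) me.
- rewrite (shift_dist sn) (lt_le_trans _ be)// ltr_pM2l//.
  by apply: word_weight_gt0; [case/andP: b1_01|case/andP: b2_01].
- exact: le_lt_trans (pi1_agree_dist t1_01 t2_01 sn) te.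
Qed.

(** The reverse inclusion. The symbols at [i] and [j] put the first coordinate away from dyadic end
    points, so the ball fixes [m] past symbols; the third coordinate fixes symbols 0 to [n - 1], and
    rescaling the second gives the line ball. *)
Lemma cube_mass_upper s m N n e r (i j : nat) : t1 + t2 < 1 ->
  (m <= i < N)%N -> (m <= j < N)%N -> reflect s i%:Z -> ~~ reflect s j%:Z ->
  e <= 2^-1 ^+ N ->
  e <= word_weight t1 t2 (first n) s * (2 * (1 - t1 - t2)) ->
  e <= word_weight b1 b2 (first n) s * r ->
  cube_mass s e <=
    word_weight p (1 - p) (around m n) s * line_mass b1 b2 (shift n s) r.
Proof.
move=> t12 iN jN si sj Ne te be; rewrite -lee_fin cube_massE split_mass.
apply: le_measure; rewrite ?inE; [by []|exact: measurable_split|].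
move=> s' /cube_ball_coord[past_e b_e t_e].
have sm k : k \in before m -> s' k = s k.
  move=> /reflect_before[l lm lE]; rewrite !lE.
  apply/esym; apply: (pi1_half_separation iN jN si sj) lm.
  move: past_e; rewrite distrC !past_pi1 => past_e.
  exact: lt_le_trans past_e Ne.
have sn k : k \in first n -> s' k = s k.
  rewrite mem_first; case: k => // k /andP[_ kn].
  apply/esym; apply: (pi1_separation t1_01 t2_01 t12) kn.
  by rewrite distrC (lt_le_trans t_e).
split; first by move=> k; rewrite mem_cat => /orP[/sm|/sn].
have W0 : 0 < word_weight b1 b2 (first n) s.
  by apply: word_weight_gt0; [case/andP: b1_01|case/andP: b2_01].
rewrite /= -(ltr_pM2l W0) -shift_dist => [|k /sn//].
exact: lt_le_trans b_e be.
Qed.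

Lemma cube_mass_gt0 s e : 0 < e -> 0 < cube_mass s e.
Proof.
move=> e0; have e20 : 0 < e / 2 by rewrite divr_gt0.
have h01 : 0 < (2^-1 : R) < 1 by rewrite invr_gt0 invf_lt1 ?ltr1n ?ltr0n.
near \oo => n.
apply: (@lt_le_trans _ _ (word_weight p (1 - p) (around n n) s *
    line_mass b1 b2 (shift n s) (e / 2))).
  by rewrite mulr_gt0 ?cylinder_weight_gt0 ?line_mass_gt0.
apply: cube_mass_lower => //.
- rewrite -[in ltLHS](size_first n) -(@word_weight_half _ (first n) s).
  by near: n; apply: word_weight_first_cvg0.
- by near: n; apply: word_weight_first_cvg0.
- by rewrite ler_piMl ?(ltW e20)// word_weight_le1.
Unshelve. all: by end_near.
Qed.

End cube.

End ball_estimates.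

(** * Exponential rates *)

Section exponential_rates.
Context d (T : measurableType d) (R : realType) (P : probability T R).
Implicit Types (X Y : nat * T -> R).

(** That is, [X = exp(n (l + o(1)))] in probability, [n] being the time component. *)
Definition rate X (l : R) := (forall z, 0 < X z) /\
  ln (X z) / z.1%:R @[z --> whp P] --> l.

Lemma rateM X Y l l' : rate X l -> rate Y l' -> rate (fun z => X z * Y z) (l + l').
Proof.
move=> [X0 Xl] [Y0 Yl]; split => [z|]; first by rewrite mulr_gt0.
under eq_fun do rewrite lnM ?posrE// mulrDl.
exact: (cvgD Xl Yl).
Qed.

Lemma rate_cst (C : R) : 0 < C -> rate (fun=> C) 0.
Proof.
move=> C0; split => //.
rewrite -[X in _ --> X](mulr0 (ln C)); apply: cvgM; first exact: cvg_cst.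
have n0 : n%:R^-1 @[n --> \oo] --> (0 : R).
  by rewrite -cvg_shiftS; exact: cvg_harmonic.
exact: (cvg_whp P n0).
Qed.

Lemma near_whp_gt0 : \forall z \near whp P, (0 < z.1)%N.
Proof. by apply: (@near_whp _ _ _ P (fun n => (0 < n)%N)); exists 1%N. Qed.

Lemma rate_expR (a : R) : rate (fun z => expR (a * z.1%:R)) a.
Proof.
split => [z|]; first exact: expR_gt0.
apply: cvg_near_cst; near=> z.
have z0 : (0 < z.1)%N by near: z; exact: near_whp_gt0.
by rewrite expRK mulfK// pnatr_eq0 -lt0n.
Unshelve. all: by end_near.
Qed.

(** A gap between exponents absorbs all subexponential factors. The conditions on radii are checked
    this way. *)
Lemma rate_lt X Y l l' : rate X l -> rate Y l' -> l < l' ->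
  \forall z \near whp P, X z < Y z.
Proof.
move=> [X0 Xl] [Y0 Yl] ll'.
have lm : l < (l + l') / 2 by lra.
have ml' : (l + l') / 2 < l' by lra.
near=> z.
have z0 : 0 < z.1%:R :> R by rewrite ltr0n; near: z; exact: near_whp_gt0.
rewrite -ltr_ln ?posrE// -(ltr_pM2r (_ : 0 < z.1%:R^-1)) ?invr_gt0//.
apply: (@lt_trans _ _ ((l + l') / 2)); near: z.
  exact: (cvgr_lt l).
exact: (cvgr_gt l').
Unshelve. all: by end_near.
Qed.

(** The way back from masses to exponents: otherwise [rate_lt] would contradict the estimate at some
    pair. *)
Lemma rate_le X Y l l' : rate X l -> rate Y l' ->
  (\forall z \near whp P, X z <= Y z) -> l <= l'.
Proof.
move=> rX rY XY; rewrite leNgt; apply/negP => l'l.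
near (whp P) => z.
have : X z <= Y z by near: z.
rewrite leNgt => /negP; apply; near: z.
exact: rate_lt l'l.
Unshelve. all: by end_near.
Qed.

Lemma rate_exprn (x : R) (m : nat -> nat) (k : R) : 0 < x ->
  (m n)%:R / n%:R @[n --> \oo] --> k -> rate (fun z => x ^+ m z.1) (k * ln x).
Proof.
move=> x0 mk; split => [z|]; first exact: exprn_gt0.
under eq_fun do rewrite lnXn// -(mulr_natl (ln x)) mulrAC.
exact: (cvgM (cvg_whp P mk) (cvg_cst _)).
Qed.

End exponential_rates.

Lemma truncn_rate (R : realType) (k : R) : 0 <= k ->
  (Num.truncn (k * n%:R))%:R / n%:R @[n --> \oo] --> k.
Proof.
move=> k0; apply/cvgrPdist_le => e e0.
have /cvgrPdist_le/(_ e e0) : n%:R^-1 @[n --> \oo] --> (0 : R).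
  by rewrite -cvg_shiftS; exact: cvg_harmonic.
move=> H; near=> n.
have n0 : 0 < n%:R :> R by rewrite ltr0n; near: n; exists 1%N.
have kn : 0 <= k * n%:R by rewrite mulr_ge0.
have h1 : (Num.truncn (k * n%:R))%:R <= k * n%:R by rewrite truncn_le.
have h2 := truncnS_gt (k * n%:R).
have : `|0 - n%:R^-1| <= e by near: n.
rewrite sub0r normrN gtr0_norm ?invr_gt0//; apply: le_trans.
rewrite -[X in `|X - _|](mulfK (lt0r_neq0 n0)) -mulrBl normrM.
rewrite [X in _ * X]gtr0_norm ?invr_gt0// ler_piMl ?invr_ge0 ?ler0n//.
by move: h2; rewrite -natr1 ger0_norm ?subr_ge0//; lra.
Unshelve. all: by end_near.
Qed.

(** * Rates of cylinder weights and ball masses *)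

Section symbolic_rates.
Context (R : realType) (p : R) (P : probability Sigma R).
Hypotheses (p_01 : 0 < p < 1) (PE : is_bernoulli_measure p P).

Let p01 : 0 <= p <= 1.
Proof. by case/andP: p_01 => p0 p1; rewrite !ltW. Qed.

Lemma rate_word_weight a b (J : nat -> seq int) (x : R) : 0 < a -> 0 < b ->
  (forall n, uniq (J n)) -> (size (J n))%:R / n%:R @[n --> \oo] --> x ->
  rate P (fun z => word_weight a b (J z.1) z.2) (x * mean_log p a b).
Proof.
move=> a0 b0 uJ Jx; split => [z|]; first exact: word_weight_gt0.
exact: cvg_ln_word_weight.
Qed.

Lemma rate_word_weight_first a b : 0 < a -> 0 < b ->
  rate P (fun z => word_weight a b (first z.1) z.2) (mean_log p a b).
Proof.
move=> a0 b0; rewrite -[mean_log p a b]mul1r; apply: rate_word_weight => //.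
  exact: uniq_first.
apply: cvg_near_cst; exists 1%N => // n /= n0.
by rewrite size_first divff// pnatr_eq0 -lt0n.
Qed.

Lemma rate_word_weight_around (m : nat -> nat) (k : R) :
  (m n)%:R / n%:R @[n --> \oo] --> k ->
  rate P (fun z => word_weight p (1 - p) (around (m z.1) z.1) z.2)
    ((1 + k) * mean_log p p (1 - p)).
Proof.
move=> mk; case/andP: p_01 => p0 p1.
apply: (@rate_word_weight _ _ (fun n => around (m n) n)) => //.
- by rewrite subr_gt0.
- by move=> n; exact: uniq_around.
rewrite addrC.
under eq_fun do rewrite size_around natrD mulrDl.
have n1 : n%:R / n%:R @[n --> \oo] --> (1 : R).
  apply: cvg_near_cst; exists 1%N => // n /= n0.
  by rewrite divff// pnatr_eq0 -lt0n.
exact: (cvgD mk n1).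
Qed.

(** The exceptional set at time [n] is pulled back by [shift n], which preserves its mass. In
    probability only the law at each time matters, so the shift may depend on time. *)
Lemma whp_shift (A : set (nat * Sigma)) : whp P A ->
  whp P [set z | A (z.1, shift z.1 z.2)].
Proof.
move=> hA e e0; apply: filterS (hA e e0) => n [B [mB AB PB]].
exists (shift n @^-1` B); split.
- by rewrite -[X in measurable X]setTI; exact: measurable_shift.
- by move=> s; exact: AB.
- by rewrite (bernoulli_shift PE).
Qed.

Lemma rate_shift (X : nat * Sigma -> R) l : rate P X l ->
  rate P (fun z => X (z.1, shift z.1 z.2)) l.
Proof.
move=> [X0 Xl]; split => [z|]; first exact: X0.
by move=> U /Xl/whp_shift.
Qed.

(** Along the radii [exp(- a n)] the denominator [ln e] is [- a n]; almost sure convergence then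
    weakens to convergence in probability. *)
Lemma has_dimension_rate q (X : {mfun Sigma >-> q.-tuple R}) c (a : R) : 0 < a ->
  has_dimension (distribution P X) c ->
  (forall s e, 0 < e -> 0 < fine (distribution P X (euclidean_ball (X s) e))) ->
  rate P (fun z => fine (distribution P X
    (euclidean_ball (X z.2) (expR (- a * z.1%:R))))) (- a * c).
Proof.
move=> a0 Xc pos; split => [z|]; first by apply: pos; exact: expR_gt0.
apply: (@ae_cvg_whp _ _ _ P (fun n s => ln (fine (distribution P X
    (euclidean_ball (X s) (expR (- a * n%:R))))) / n%:R)) => [n|].
  apply: measurable_funM => //; apply: measurableT_comp => //.
  apply: measurableT_comp; first exact: fine_measurable.
  apply: (measurableT_comp (measurable_ball_measure (distribution P X) _)).
  exact: measurable_funP.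
case: Xc => N [mN N0 HN].
exists (X @^-1` N); split.
- exact: measurable_funPTI.
- by rewrite -N0.
move=> s ns; apply: HN => /= Xc; apply: ns.
have en : expR (- a * n%:R) @[n --> \oo] --> (0 : R).
  under eq_fun do rewrite expRM_natr.
  by apply: cvg_expr; rewrite gtr0_norm ?expR_gt0// expR_lt1 oppr_lt0.
have e0 n : 0 < expR (- a * n%:R) by exact: expR_gt0.
have h := (cvg_at_rightP _ _ _).1 Xc _ (conj e0 en).
apply: cvg_trans (cvgM (cvg_cst (- a)) h).
(* The identity also holds at [n = 0], where both divisions by 0 give 0. *)
apply: near_eq_cvg; apply: nearW => n /=.
by rewrite expRK invfM mulrCA mulVKf ?oppr_eq0 ?gt_eqF.
Qed.

(** The window of past times has length about [k * n], so by the law of large numbers both symbols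
    occur in it, as [0 < p < 1]. This supplies the witnesses for [cube_mass_upper]. *)
Lemma near_window_symbols (m N : nat -> nat) (k : R) :
  (forall n, (m n <= N n)%N) -> 0 < k ->
  (N n - m n)%:R / n%:R @[n --> \oo] --> k ->
  \forall z \near whp P, exists i j : nat,
    [/\ (m z.1 <= i < N z.1)%N, (m z.1 <= j < N z.1)%N,
       reflect z.2 i%:Z & ~~ reflect z.2 j%:Z].
Proof.
move=> mN k0 mNk; case/andP: p_01 => p0 p1.
pose J n : seq int := [seq - (i%:Z + 1) | i <- iota (m n) (N n - m n)].
have memJ n x : x \in J n -> exists2 i, (m n <= i < N n)%N &
    forall s, s x = reflect s i%:Z.
  move=> /mapP[i + ->]; rewrite mem_iota subnKC// => im.
  by exists i.
have uJ n : uniq (J n).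
  by rewrite map_inj_uniq ?iota_uniq// => i j /oppr_inj/addIr[].
have sJ n : size (J n) = (N n - m n)%N by rewrite size_map size_iota.
have Jk : (size (J n))%:R / n%:R @[n --> \oo] --> k.
  by under eq_fun do rewrite sJ.
have H := law_of_large_numbers p01 PE uJ Jk.
have H' : (size (J z.1))%:R / z.1%:R - num_ones R (J z.1) z.2 / z.1%:R
    @[z --> whp P] --> k - k * p.
  exact: (cvgB (cvg_whp P Jk) H).
have kp0 : 0 < k * p by rewrite mulr_gt0.
have kp1 : 0 < k - k * p by rewrite subr_gt0 gtr_pMr.
near=> z.
have n0 : 0 < z.1%:R :> R by rewrite ltr0n; near: z; exact: near_whp_gt0.
have h1 : 0 < num_ones R (J z.1) z.2 / z.1%:R.
  by near: z; exact: (cvgr_gt _ H).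
have h2 : 0 < (size (J z.1))%:R / z.1%:R - num_ones R (J z.1) z.2 / z.1%:R.
  by near: z; exact: (cvgr_gt _ H').
have : has (fun x => z.2 x) (J z.1).
  apply: contraLR h1 => /hasPn nJ; rewrite -leNgt.
  rewrite /num_ones big_seq big1 ?mul0r// => x xJ.
  by rewrite (negbTE (nJ x xJ)).
have : has (fun x => ~~ z.2 x) (J z.1).
  apply: contraLR h2 => /hasPn nJ; rewrite -leNgt -mulrBl.
  rewrite /num_ones big_seq (eq_bigr (fun=> 1)) => [|x xJ]; last first.
    by have := nJ x xJ; rewrite negbK => ->.
  by rewrite -big_seq big_const_seq count_predT iter_addr_0 subrr mul0r.
move=> /hasP[x /memJ[j jN jE] xj] /hasP[y /memJ[i iN iE] yi].
by exists i, j; split => //; [rewrite -iE|rewrite -jE].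
Unshelve. all: by end_near.
Qed.

Lemma rate_line_mass g1 g2 c (a : R) : 0 < g1 < 1 -> 0 < g2 < 1 -> 0 < a ->
  has_dimension (distribution P (pi_line g1 g2)) c ->
  rate P (fun z => line_mass P g1 g2 z.2 (expR (- a * z.1%:R))) (- a * c).
Proof.
move=> g1_01 g2_01 a0 hc.
exact: (has_dimension_rate a0 hc (line_mass_gt0 p_01 PE g1_01 g2_01)).
Qed.

Section line_dimension.
Variables (t1 t2 c : R).
Hypotheses (t1_01 : 0 < t1 < 1) (t2_01 : 0 < t2 < 1) (t12 : t1 + t2 < 1).
Hypothesis hc : has_dimension (distribution P (pi_line t1 t2)) c.

Let Wt := rate_word_weight_first (proj1 (andP t1_01)) (proj1 (andP t2_01)).

Let cylinder_rate : rate P (fun z => word_weight p (1 - p) (first z.1) z.2)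
  (mean_log p p (1 - p)).
Proof.
by case/andP: p_01 => p0 p1; apply: rate_word_weight_first; rewrite ?subr_gt0.
Qed.

(** For [a] below the Lyapunov exponent the radius [exp(- a n)] exceeds the size of the cylinder of
    length [n], so the ball contains it. *)
Lemma line_dimension_le a : 0 < a -> a < - mean_log p t1 t2 ->
  mean_log p p (1 - p) <= - a * c.
Proof.
move=> a0 at_; apply: rate_le cylinder_rate (rate_line_mass t1_01 t2_01 a0 hc) _.
near=> z; apply: line_mass_lower => //.
near: z; apply: rate_lt (rateM (rate_cst P (ltr0Sn R 1)) Wt) (rate_expR P (- a)) _.
by rewrite add0r; lra.
Unshelve. all: by end_near.
Qed.

(** For [a] above the exponent the radius falls below the separation scale, and the cylinder
    contains the ball. *)
Lemma line_dimension_ge a : 0 < a -> - mean_log p t1 t2 < a ->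
  - a * c <= mean_log p p (1 - p).
Proof.
move=> a0 at_; apply: rate_le (rate_line_mass t1_01 t2_01 a0 hc) cylinder_rate _.
have t12' : 0 < 2 * (1 - t1 - t2) by move: t12; lra.
near=> z; apply: line_mass_upper => //; apply: ltW; near: z.
apply: rate_lt (rate_expR P (- a)) (rateM Wt (rate_cst P t12')) _.
by rewrite addr0; lra.
Unshelve. all: by end_near.
Qed.

End line_dimension.

(** * Upper and lower bounds for the dimension of the cube measure *)

Section cube_dimension.
Variables (b1 b2 t1 t2 c : R).
Hypotheses (b1_01 : 0 < b1 < 1) (b2_01 : 0 < b2 < 1).
Hypotheses (t1_01 : 0 < t1 < 1) (t2_01 : 0 < t2 < 1) (t12 : t1 + t2 < 1).
Hypothesis hc : has_dimension (distribution P (pi_cube b1 b2 t1 t2)) c.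

Let Wt := rate_word_weight_first (proj1 (andP t1_01)) (proj1 (andP t2_01)).
Let Wb := rate_word_weight_first (proj1 (andP b1_01)) (proj1 (andP b2_01)).

Let rate_cube_mass a : 0 < a ->
  rate P (fun z => cube_mass P b1 b2 t1 t2 z.2 (expR (- a * z.1%:R))) (- a * c).
Proof.
move=> a0.
exact: (has_dimension_rate a0 hc
  (cube_mass_gt0 p_01 PE b1_01 b2_01 t1_01 t2_01)).
Qed.

Let half_gt0 : (0 < 2^-1 :> R). Proof. by rewrite invr_gt0. Qed.

(** Here [a] is the rate of the cube radius, [r] that of the line radius, [k] the number of past
    symbols per unit of time. The last three inequalities give the conditions of [cube_mass_lower]
    with room for subexponential errors. *)
Lemma cube_dimension_le a k r d : 0 < a -> 0 <= k -> 0 < r ->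
  has_dimension (distribution P (pi_line b1 b2)) d ->
  a < k * ln 2 -> a < - mean_log p t1 t2 -> a + mean_log p b1 b2 < r ->
  (1 + k) * mean_log p p (1 - p) - r * d <= - a * c.
Proof.
move=> a0 k0 r0 hd ak at_ abr.
have mk := truncn_rate k0; set m := (fun n => Num.truncn (k * n%:R)) in mk.
have lhs := rateM (rate_word_weight_around mk)
  (rate_shift (rate_line_mass b1_01 b2_01 r0 hd)).
rewrite -mulNr; apply: rate_le lhs (rate_cube_mass a0) _.
have re2 := rateM (rate_expR P (- a)) (rate_cst P half_gt0).
near=> z; apply: cube_mass_lower => //; first exact: expR_gt0.
- near: z; apply: rate_lt
    (rateM (rate_cst P (ltr0Sn R 1)) (rate_exprn P half_gt0 mk)) re2 _.
  by rewrite add0r addr0 lnV ?posrE//; lra.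
- near: z; apply: rate_lt (rateM (rate_cst P (ltr0Sn R 1)) Wt) re2 _.
  by rewrite add0r addr0; lra.
- apply: ltW; near: z; apply: rate_lt (rateM Wb (rate_expR P (- r))) re2 _.
  by rewrite addr0; lra.
Unshelve. all: by end_near.
Qed.

(** The line radius [f] is left free: it is exponential in one application and depends on the point
    in the other. *)
Let cube_mass_near a k (f : nat * Sigma -> R) : 0 < a -> 0 <= k ->
  k * ln 2 < a -> - mean_log p t1 t2 < a ->
  (\forall z \near whp P, expR (- a * z.1%:R) <=
     word_weight b1 b2 (first z.1) z.2 * f z) ->
  \forall z \near whp P, cube_mass P b1 b2 t1 t2 z.2 (expR (- a * z.1%:R)) <=
    word_weight p (1 - p) (around (Num.truncn (k * z.1%:R)) z.1) z.2 *
    line_mass P b1 b2 (shift z.1 z.2) (f z).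
Proof.
move=> a0 k0 ka at_ bf.
have ln2 : 0 < ln (2 : R) by rewrite ln_gt0// ltr1n.
(* [k + h] is the midpoint of [k] and [a / ln 2]: the window from [k n] to [(k + h) n] has positive
   proportion, and its dyadic scale stays above the radius. *)
pose h := (a / ln 2 - k) / 2.
have h0 : 0 < h by rewrite divr_gt0// subr_gt0 ltr_pdivlMr.
have kh : (k + h) * ln 2 < a.
  have -> : (k + h) * ln 2 = (k * ln 2 + a) / 2.
    by rewrite /h; field; rewrite gt_eqF.
  by lra.
have mk := truncn_rate k0; set m := (fun n => Num.truncn (k * n%:R)) in mk.
have qh := truncn_rate (ltW h0); set q := (fun n => Num.truncn (h * n%:R)) in qh.
pose N n := (m n + q n)%N.
have Nk : (N n)%:R / n%:R @[n --> \oo] --> k + h.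
  by under eq_fun do rewrite natrD mulrDl; exact: (cvgD mk qh).
have mN n : (m n <= N n)%N by rewrite leq_addr.
have Nm : (N n - m n)%:R / n%:R @[n --> \oo] --> h.
  by under eq_fun do rewrite addKn.
have t12' : 0 < 2 * (1 - t1 - t2) by move: t12; lra.
near=> z.
have [i [j [iN jN si sj]]] : exists i j : nat,
    [/\ (m z.1 <= i < N z.1)%N, (m z.1 <= j < N z.1)%N,
       reflect z.2 i%:Z & ~~ reflect z.2 j%:Z].
  by near: z; exact: near_window_symbols Nm.
apply: (cube_mass_upper p_01 PE b1_01 b2_01 t1_01 t2_01 t12 iN jN si sj).
- apply: ltW; near: z.
  apply: rate_lt (rate_expR P (- a)) (rate_exprn P half_gt0 Nk) _.
  by rewrite lnV ?posrE//; lra.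
- apply: ltW; near: z.
  apply: rate_lt (rate_expR P (- a)) (rateM Wt (rate_cst P t12')) _.
  by rewrite addr0; lra.
- by near: z.
Unshelve. all: by end_near.
Qed.

Lemma cube_dimension_ge a k r d : 0 < a -> 0 <= k -> 0 < r ->
  has_dimension (distribution P (pi_line b1 b2)) d ->
  k * ln 2 < a -> - mean_log p t1 t2 < a -> r < a + mean_log p b1 b2 ->
  - a * c <= (1 + k) * mean_log p p (1 - p) - r * d.
Proof.
move=> a0 k0 r0 hd ka at_ rab.
have mk := truncn_rate k0.
have rhs := rateM (rate_word_weight_around mk)
  (rate_shift (rate_line_mass b1_01 b2_01 r0 hd)).
rewrite -mulNr; apply: rate_le (rate_cube_mass a0) rhs _.
apply: cube_mass_near => //.
near=> z; apply: ltW; near: z.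
apply: rate_lt (rate_expR P (- a)) (rateM Wb (rate_expR P (- r))) _.
by lra.
Unshelve. all: by end_near.
Qed.

(** The line mass is bounded by 1, which suffices when the second coordinate contracts faster than
    the third. *)
Lemma cube_dimension_ge_entropy a k : 0 < a -> 0 <= k ->
  k * ln 2 < a -> - mean_log p t1 t2 < a ->
  - a * c <= (1 + k) * mean_log p p (1 - p).
Proof.
move=> a0 k0 ka at_.
have rhs := rate_word_weight_around (truncn_rate k0).
apply: rate_le (rate_cube_mass a0) rhs _.
near=> z.
(* This radius makes the condition on the second coordinate an equality. *)
pose f (z : nat * Sigma) : R :=
  expR (- a * z.1%:R) / word_weight b1 b2 (first z.1) z.2.
have : cube_mass P b1 b2 t1 t2 z.2 (expR (- a * z.1%:R)) <=
    word_weight p (1 - p) (around (Num.truncn (k * z.1%:R)) z.1) z.2 *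
    line_mass P b1 b2 (shift z.1 z.2) (f z).
  near: z; apply: cube_mass_near => //; near=> z.
  by rewrite /f [leRHS]mulrC divfK// gt_eqF//; case: Wb.
move=> /le_trans; apply; rewrite ler_piMr ?line_mass_le1//.
exact/ltW/cylinder_weight_gt0.
Unshelve. all: by end_near.
Qed.

End cube_dimension.

End symbolic_rates.

(** * Conclusion *)

(** An error linear in [e] tends to 0; the bound [E] serves to keep perturbed rates positive. *)
Lemma le_of_small_perturbations (R : realFieldType) (x y z E : R) : 0 < E ->
  (forall e, 0 < e -> e < E -> x <= y + e * z) -> x <= y.
Proof.
move=> E0 h; apply/ler_addgt0Pr => e e0.
have z0 : 0 < `|z| + 1 by rewrite ltr_wpDl.
pose f := Num.min (E / 2) (e / (`|z| + 1)).
have f0 : 0 < f by rewrite lt_min !divr_gt0.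
have fE : f < E by rewrite gt_min; apply/orP; left; lra.
apply: le_trans (h f f0 fE) _; rewrite lerD2l.
have fz : f * (`|z| + 1) <= e by rewrite -ler_pdivlMr// ge_min lexx orbT.
apply: le_trans fz; rewrite ler_pM2l//.
by rewrite (le_trans (ler_norm _))// lerDl.
Qed.

Lemma mean_log_lt0 (R : realType) (p a b : R) : 0 < p < 1 -> 0 < a < 1 ->
  0 < b < 1 -> mean_log p a b < 0.
Proof.
move=> /andP[p0 p1] a01 b01; have la := ln_lt0 a01; have lb := ln_lt0 b01.
have q0 : 0 < 1 - p by rewrite subr_gt0.
by rewrite /mean_log -[ltRHS]addr0 ltrD// pmulr_rlt0.
Qed.

Unset Implicit Arguments.

Theorem corollary6p1 (R : realType) (b1 b2 t1 t2 p : R)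
    (bp : probability Sigma R)
    (b1_01 : 0 < b1 < 1) (b2_01 : 0 < b2 < 1)
    (t1_01 : 0 < t1 < 1) (t2_01 : 0 < t2 < 1)
    (t12 : t1 + t2 < 1) (p_01 : 0 < p < 1)
    (bpE : is_bernoulli_measure p bp)
    (exact_cube : exact_dimensional (distribution bp (pi_cube b1 b2 t1 t2)))
    (exact_b : exact_dimensional (distribution bp (pi_line b1 b2)))
    (exact_t : exact_dimensional (distribution bp (pi_line t1 t2))) :
  (mean_log p b1 b2 >= mean_log p t1 t2 ->
    dimension (distribution bp (pi_cube b1 b2 t1 t2)) =
      - (mean_log p p (1 - p) / ln 2)
      + mean_log p p (1 - p) / mean_log p t1 t2
      + (1 - mean_log p b1 b2 / mean_log p t1 t2)
        * dimension (distribution bp (pi_line b1 b2))) /\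
  (mean_log p b1 b2 < mean_log p t1 t2 ->
    dimension (distribution bp (pi_cube b1 b2 t1 t2)) =
      - (mean_log p p (1 - p) / ln 2)
      + mean_log p p (1 - p) / mean_log p b1 b2
      + (1 - mean_log p t1 t2 / mean_log p b1 b2)
        * dimension (distribution bp (pi_line t1 t2))).
Proof.
have [c hc] := exact_cube; have [d hd] := exact_b; have [dt hdt] := exact_t.
rewrite (dimensionE hc) (dimensionE hd) (dimensionE hdt).
have Lb0 : mean_log p b1 b2 < 0 by exact: mean_log_lt0.
have Lt0 : mean_log p t1 t2 < 0 by exact: mean_log_lt0.
have ln2 : 0 < ln (2 : R) by rewrite ln_gt0// ltr1n.
have cube_le := @cube_dimension_le _ _ _ p_01 bpE _ _ _ _ _
  b1_01 b2_01 t1_01 t2_01 hc.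
have cube_ge := @cube_dimension_ge _ _ _ p_01 bpE _ _ _ _ _
  b1_01 b2_01 t1_01 t2_01 t12 hc.
have cube_ge_entropy := @cube_dimension_ge_entropy _ _ _ p_01 bpE _ _ _ _ _
  b1_01 b2_01 t1_01 t2_01 t12 hc.
have line_le := @line_dimension_le _ _ _ p_01 bpE _ _ _ t1_01 t2_01 hdt.
have line_ge := @line_dimension_ge _ _ _ p_01 bpE _ _ _ t1_01 t2_01 t12 hdt.
(* The rest is real arithmetic: [H] will be minus the entropy, [Lb] and [Lt] minus the Lyapunov
   exponents. *)
move: (mean_log p p (1 - p)) (mean_log p b1 b2) (mean_log p t1 t2) Lb0 Lt0
  cube_le cube_ge cube_ge_entropy line_le line_ge.
move: (ln 2) ln2 => l l0 H Lb Lt Lb0 Lt0 cube_le cube_ge cube_ge_entropy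
  line_le line_ge.
(* Solves [2 ^ (- k n) = exp(n Lt)], matching the dyadic scale with that of the third coordinate. *)
pose k := - Lt / l.
have k0 : 0 <= k by rewrite divr_ge0 ?(ltW l0)// oppr_ge0 ltW.
have kl : k * l = - Lt by rewrite divfK// gt_eqF.
(* The first case takes [r = Lb - Lt], the second [r = 0]. *)
have lower r : 0 <= r -> Lb - Lt <= r -> (1 + k) * H - r * d <= Lt * c.
  move=> r0 Lr; apply: (@le_of_small_perturbations _ _ _ (c + d) (- Lt)).
    by rewrite oppr_gt0.
  move=> e e0 eE; have := cube_le (- Lt - e) k (r + e) d.
  rewrite kl => /(_ _ _ _ hd); rewrite opprB; lra.
have upper : 0 <= Lb - Lt -> Lt * c <= (1 + k) * H - (Lb - Lt) * d.
  move=> Lr; apply: (@le_of_small_perturbations _ _ _ (c - d / 2) 1) => // e e0 _.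
  (* The term [e / 2] keeps the line rate positive even if [Lb = Lt], and below [Lb - Lt + e]. *)
  have := cube_ge (- Lt + e) k (Lb - Lt + e / 2) d.
  rewrite kl => /(_ _ _ _ hd); lra.
have upper_entropy : Lt * c <= (1 + k) * H.
  apply: (@le_of_small_perturbations _ _ _ c 1) => // e e0 _.
  have := cube_ge_entropy (- Lt + e) k; rewrite kl; lra.
(* The rate [a] tends to [- Lt] from both sides. *)
have lineE : H = Lt * dt.
  apply/eqP; rewrite eq_le; apply/andP; split.
    apply: (@le_of_small_perturbations _ _ _ dt (- Lt)) => [|e e0 eE].
      by rewrite oppr_gt0.
    have := line_le (- Lt - e); lra.
  apply: (@le_of_small_perturbations _ _ _ dt 1) => // e e0 _.
  have := line_ge (- Lt + e); lra.
have ln : l != 0 by rewrite gt_eqF.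
have Ltn : Lt != 0 by rewrite lt_eqF.
have Lbn : Lb != 0 by rewrite lt_eqF.
split=> LbLt.
  have cE : Lt * c = (1 + k) * H - (Lb - Lt) * d.
    by apply/eqP; rewrite eq_le upper ?lower// subr_ge0.
  by apply: (mulfI Ltn); rewrite cE /k; field; rewrite ln Ltn.
have cE : Lt * c = (1 + k) * H.
  apply/eqP; rewrite eq_le upper_entropy/=.
  by have := lower 0; rewrite mul0r subr0; apply => //; lra.
(* With [H = Lt * dt] the last two terms of the formula add up to [dt], that is [H / Lt]. *)
by apply: (mulfI Ltn); rewrite cE /k lineE; field; rewrite ln Lbn.
Qed.
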